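(* Let $R$ be a finite commutative ring with $1$ and let $I$ be a proper nonzero ideal of $R$. Suppose that $\omega(\Gamma(R/I))\geq 4$ or $\gamma(\Gamma(R/I))\geq 1$. Then $\gamma(\Gamma_I(R))\geq 2$.
   Context: All rings are commutative with $1$. For a ring $S$, the zero-divisor graph $\Gamma(S)$ is the simple graph whose vertices are the nonzero zero-divisors of $S$, two distinct vertices $x,y$ being adjacent if and only if $xy=0$. For an ideal $I$ of a ring $R$, $\Gamma_I(R)$ is the simple graph with vertex set $\{x\in R\setminus I : xy\in I \text{ for some } y\in R\setminus I\}$, in which distinct vertices $x,y$ are adjacent if and only if $xy\in I$. For a graph $G$, the clique number $\omega(G)$ is the greatest integer $n\ge 1$ such that the complete graph $K_n$ is a (not necessarily induced) subgraph of $G$. The genus $\gamma(G)$ is the least $g\ge 0$ such that $G$ can be drawn without edge crossings on the orientable surface of genus $g$ (the sphere with $g$ handles); planar graphs are those of genus $0$. *)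

(* Defs.v *)
From HB Require Import structures.
From mathcomp Require Import all_boot all_order all_algebra.
From mathcomp Require Import generic_quotient ring_quotient.
From mathcomp Require Import all_classical all_reals all_analysis.

Set Implicit Arguments.
Unset Strict Implicit.
Unset Printing Implicit Defensive.
Import Order.TTheory GRing.Theory Num.Theory.
Import numFieldNormedType.Exports.
Local Open Scope ring_scope.

Section FiniteQuotient.
Variables (R : finComNzRingType) (I : idealr R).
Local Notation Q := (Quotient.quot I).

Lemma quot_pickleK : pcancel (fun x : Q => pickle (repr x))
  (fun n => omap (\pi_Q)%qT (unpickle n)).
Proof. by move=> x; rewrite /= pickleK /= reprK. Qed.

HB.instance Definition _ := Choice_isCountable.Build Q quot_pickleK.

Lemma quot_enumP : Finite.axiom (undup [seq (\pi_Q x)%qT | x <- enum R]).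
Proof.
move=> x; rewrite count_uniq_mem ?undup_uniq// mem_undup.
by rewrite -[x]reprK map_f ?mem_enum.
Qed.

HB.instance Definition _ := fintype.isFinite.Build Q quot_enumP.

End FiniteQuotient.

Record sgraph := SGraph {
  vertex :> finType;
  adj : rel vertex;
  adj_sym : symmetric adj;
  adj_irr : irreflexive adj
}.

Definition edges (G : sgraph) : {set {set G}} :=
  [set E : {set G} |
    [exists x : G, exists y : G, adj x y && (E == [set x; y])%SET]]%SET.

Definition has_complete_subgraph (G : sgraph) (n : nat) : bool :=
  [exists f : {ffun 'I_n -> G}, injectiveb f &&
     [forall i, forall j, (i != j) ==> adj (f i) (f j)]].

(* K_n has n vertices, so n <= #|G| loses nothing.  The graph without
   vertices gets clique number 0. *)
Definition clique_number (G : sgraph) : nat :=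
  \max_(n < #|G|.+1 | has_complete_subgraph G n) n.

Section ZeroDivisorGraph.
Variable S : finComNzRingType.

Definition nonzero_zero_divisor (x : S) : bool :=
  (x != 0) && [exists y : S, (y != 0) && (x * y == 0)].

Definition zdg_adj (x y : {x : S | nonzero_zero_divisor x}) : bool :=
  (x != y) && (val x * val y == 0).

Lemma zdg_adj_sym : symmetric zdg_adj.
Proof. by move=> x y; rewrite /zdg_adj eq_sym mulrC. Qed.

Lemma zdg_adj_irr : irreflexive zdg_adj.
Proof. by move=> x; rewrite /zdg_adj eqxx. Qed.

Definition zero_divisor_graph : sgraph := SGraph zdg_adj_sym zdg_adj_irr.

End ZeroDivisorGraph.

Section IdealZeroDivisorGraph.
Variables (R : finComNzRingType) (I : idealr R).

Definition ideal_zero_divisor (x : R) : bool :=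
  (x \notin I) && [exists y : R, (y \notin I) && (x * y \in I)].

Definition izdg_adj (x y : {x : R | ideal_zero_divisor x}) : bool :=
  (x != y) && (val x * val y \in I).

Lemma izdg_adj_sym : symmetric izdg_adj.
Proof. by move=> x y; rewrite /izdg_adj eq_sym mulrC. Qed.

Lemma izdg_adj_irr : irreflexive izdg_adj.
Proof. by move=> x; rewrite /izdg_adj eqxx. Qed.

Definition ideal_zero_divisor_graph : sgraph :=
  SGraph izdg_adj_sym izdg_adj_irr.

End IdealZeroDivisorGraph.

Section Genus.
Variable K : realType.
Local Open Scope classical_set_scope.

Notation space := (K * K * K)%type.

(* The rectangular block [0, 2g+1] x [0, 3] x [0, 1] through which g square
   holes ]2i+1, 2i+2[ x ]1, 2[, i < g, have been drilled: a handlebody. *)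
Definition drilled_block (g : nat) : set space :=
  [set p | [/\ 0 <= p.1.1 <= (g.*2.+1)%:R, 0 <= p.1.2 <= 3, 0 <= p.2 <= 1
     & forall i : nat, (i < g)%N ->
         ~~ (((i.*2.+1)%:R < p.1.1 < (i.*2.+2)%:R) && (1 < p.1.2 < 2))]].

(* The frontier of this block is a sphere with g handles; for g = 0 it is the
   surface of a box. *)
Definition surface (g : nat) : set space :=
  closure (drilled_block g) `\` interior (drilled_block g).

(* The arc of the edge E is the restriction of [arc E] to [0, 1]. *)
Record drawing (S : set space) (G : sgraph)
    (pt : G -> space) (arc : {set G} -> K -> space) : Prop := Drawing {
  drawing_pt_inj : injective pt;
  drawing_pt_in : forall v, S (pt v);
  drawing_arc_cont : forall E, E \in edges G ->
    {within `[0, 1], continuous (arc E)};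
  drawing_arc_inj : forall E, E \in edges G ->
    {in `[0, 1] &, injective (arc E)};
  drawing_arc_in : forall E, E \in edges G -> arc E @` `[0, 1] `<=` S;
  drawing_arc_ends : forall E, E \in edges G ->
    [set arc E 0; arc E 1] = pt @` [set` E];
  drawing_arc_pt : forall E v, E \in edges G ->
    ~ (arc E @` `]0, 1[) (pt v);
  drawing_no_crossing : forall E F, E \in edges G -> F \in edges G ->
    E != F -> (arc E @` `]0, 1[) `&` (arc F @` `]0, 1[) = set0
}.

Definition drawable (S : set space) (G : sgraph) : Prop :=
  exists pt arc, @drawing S G pt arc.

(* An infimum of natural numbers, attained as soon as G is drawable on some
   surface g (as every finite graph is). *)
Definition genus (G : sgraph) : \bar K :=
  ereal_inf [set g%:R%:E | g in [set g : nat | drawable (surface g) G]].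

End Genus.

(* Main.v *)
Require Import Defs.
From mathcomp Require Import all_boot all_order all_algebra ring_quotient.
From mathcomp Require Import generic_quotient.
From mathcomp Require Import ring lra zify.
From mathcomp Require Import all_classical all_reals all_analysis.
From Stdlib Require Import Btauto.
Set Implicit Arguments.
Unset Strict Implicit.
Unset Printing Implicit Defensive.
Import Order.TTheory GRing.Theory Num.Theory.
Import numFieldNormedType.Exports.

(** Put S = R/I. The graph Gamma_I(R) is a blow-up of Gamma(S): a vertex x of
    Gamma(S) is replaced by the |I| >= 2 elements of its coset, and two
    elements of R are adjacent as soon as the product of their cosets is 0.
    The theorem combines a fact about finite rings with a fact about graphs on
    surfaces.

    Rings ([zero_divisor_trichotomy]). For a finite ring S one of these holds:
    Gamma(S) contains K_{2,3}; or S has four nonzero elements all of whose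
    products, squares included, vanish; or Gamma(S) is a fan, which means that
    deleting one vertex, the hub, leaves disjoint paths. If S has a nontrivial
    idempotent e, this comes from the many edges between eS and (1 - e)S; if
    not, zero divisors are nilpotent, some c <> 0 annihilates them all, and c
    is the hub. A fan has no K_4 ([fan_no_K4]) and is drawn with straight
    segments on one face of a box ([fan_drawable]), so it satisfies neither
    alternative of the hypothesis. In the two other cases the blow-up contains
    K_{4,6}, respectively K_8.

    Surfaces. It remains to see that K_{4,6} and K_8 are drawn neither on the
    torus nor on the sphere. Arcs are merely continuous, so crossings are
    counted mod 2 on fine samples of them. Give the torus coordinates in
    [0, 1)^2. An edge e gets a class h(e) in (F_2)^2, the parities of the
    number of times its arc wraps around in each direction. A point q has a
    ray: the dual path that goes up from q to the line y = 1 and then right to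
    the corner of the fundamental square; let u(q, e) be the parity of the
    number of crossings of e with this ray. Moving a point p along ab and a
    point q along cd, where ab and cd have no common end, p never meets q, and
    the total change around the rectangle of positions is controlled by the
    wraps alone ([sweep_cell], [sympl_holonomy]). The result is the relation
    of [parity_data] between the numbers u and the symplectic product of h(ab)
    and h(cd), which [drawing_parity_data] obtains from any drawing.

    The rest is linear algebra over F_2. In a sum of relations over a suitable
    family of pairs of edges the numbers u cancel. Disjoint cycles have
    orthogonal classes ([tri_tri], [quad_quad]), while the cycles of a K_5 or
    of a K_{3,3} cannot be pairwise orthogonal ([K5_parity], [K33_parity]).
    On the sphere, after removal of a vertex outside the K_5 or K_{3,3}, the
    drawing lies in a plane, where all h(e) vanish: a contradiction. On the
    torus (F_2)^2 is too small: a cycle with nonzero class forces the cycles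
    disjoint from it to be pairwise orthogonal. In K_8 the complement of a
    triangle is a K_5 ([no_parity_data_K8]); for K_{4,6} see [K46_aux]. *)

(** * Mod 2 crossing data of a graph on the torus *)

(** Identities between mod 2 sums are left to [btauto], which reads [xorb] but
    not [addb]. *)
Lemma addb_xorb b1 b2 : b1 (+) b2 = xorb b1 b2.
Proof. by case: b1 b2 => [] []. Qed.

Lemma parity_from b1 b2 b3 b4 : b3 = b4 -> b1 (+) b2 = b3 (+) b4 -> b1 = b2.
Proof. by move=> ->; rewrite addbb; case: b1 b2 => [] []. Qed.

Ltac parity := rewrite /is_true !addb_xorb; btauto.

Ltac distinct U :=
  move: (U); rewrite /= !inE !negb_or -?andbA;
  do ?[case/andP; intro]; intros;
  rewrite /= ?inE ?negb_or; do ?(apply/andP; split); rewrite // eq_sym //.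

Ltac sublist := by [let w := fresh in move=> w; rewrite !inE; do ?[case/orP];
  move=> /eqP->; rewrite eqxx ?orbT].

Definition F22 : Type := (bool * bool)%type.

Definition sympl (p q : F22) : bool := (p.1 && q.2) (+) (p.2 && q.1).

Definition add2 (p q : F22) : F22 := (p.1 (+) q.1, p.2 (+) q.2).

Lemma sympl_orthogonal2 (p q r : F22) :
  sympl p q -> sympl p r = false -> sympl q r = false -> r = (false, false).
Proof. by case: p q r => [[] []] [[] []] [[] []]. Qed.

(** The orthogonal of a nonzero vector of a symplectic plane is a line, which is
    isotropic. *)
Lemma sympl_orthogonal1 (p r s : F22) :
  p != (false, false) -> sympl p r = false -> sympl p s = false ->
  sympl r s = false.
Proof. by case: p r s => [[] []] [[] []] [[] []]. Qed.

Lemma sympl_neq0 (p q : F22) :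
  sympl p q -> (p != (false, false)) /\ (q != (false, false)).
Proof. by case: p q => [[] []] [[] []]. Qed.

(** The mod 2 intersection pattern of a drawing on the torus. The classes [h]
    record how edges wrap, [u c a b] is the parity of the crossings of the edge
    ab with the ray of c, and [o] tells which of two vertices lies to the
    right. The identity says that ab and cd cross an even number of times: the
    terms in [o] count crossings in a convex drawing, [u] those created by
    moving an edge over a vertex, [sympl] those forced by the handle. *)
Definition parity_data (V : eqType) (e : rel V) (h : V -> V -> F22)
    (u : V -> V -> V -> bool) (o : rel V) : Prop :=
  (forall a c, a != c -> o a c = ~~ o c a) /\
  (forall a b c d, uniq [:: a; b; c; d] -> e a b -> e c d ->
     sympl (h a b) (h c d) =
       u c a b (+) u d a b (+) u a c d (+) u b c d
       (+) o c a (+) o d a (+) o c b (+) o d b).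

Section ParityData.
Variables (V : eqType) (e : rel V) (h : V -> V -> F22).
Variables (u : V -> V -> V -> bool) (o : rel V).
Hypothesis huo : parity_data e h u o.

Definition tri (a b c : V) : F22 := add2 (h a b) (add2 (h b c) (h a c)).

Definition quad (a b s t : V) : F22 :=
  add2 (add2 (h a s) (h a t)) (add2 (h b s) (h b t)).

(** Sum the nine relations: for a vertex v of one triangle and an edge pq of the
    other, [u v p q] occurs once for each of the two edges at v, and cancels. *)
Lemma tri_tri (a b c x y z : V) :
  uniq [:: a; b; c; x; y; z] ->
  e a b -> e b c -> e a c -> e x y -> e y z -> e x z ->
  sympl (tri a b c) (tri x y z) = false.
Proof.
case: huo => _ H U ab bc ac xy yz xz.
have E : sympl (tri a b c) (tri x y z) =
  (sympl (h a b) (h x y) (+) sympl (h a b) (h y z) (+) sympl (h a b) (h x z))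
  (+) (sympl (h b c) (h x y) (+) sympl (h b c) (h y z)
       (+) sympl (h b c) (h x z))
  (+) (sympl (h a c) (h x y) (+) sympl (h a c) (h y z)
       (+) sympl (h a c) (h x z)).
  by rewrite /tri /add2 /sympl /=; parity.
rewrite E !H //; [by parity | distinct U..].
Qed.

Lemma quad_quad (a b s t a' b' s' t' : V) :
  uniq [:: a; b; s; t; a'; b'; s'; t'] ->
  e a s -> e a t -> e b s -> e b t ->
  e a' s' -> e a' t' -> e b' s' -> e b' t' ->
  sympl (quad a b s t) (quad a' b' s' t') = false.
Proof.
case: huo => _ H U e1 e2 e3 e4 e5 e6 e7 e8.
have E : sympl (quad a b s t) (quad a' b' s' t') =
  (sympl (h a s) (h a' s') (+) sympl (h a s) (h a' t')
   (+) sympl (h a s) (h b' s') (+) sympl (h a s) (h b' t'))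
  (+) (sympl (h a t) (h a' s') (+) sympl (h a t) (h a' t')
   (+) sympl (h a t) (h b' s') (+) sympl (h a t) (h b' t'))
  (+) (sympl (h b s) (h a' s') (+) sympl (h b s) (h a' t')
   (+) sympl (h b s) (h b' s') (+) sympl (h b s) (h b' t'))
  (+) (sympl (h b t) (h a' s') (+) sympl (h b t) (h a' t')
   (+) sympl (h b t) (h b' s') (+) sympl (h b t) (h b' t')).
  by rewrite /quad /add2 /sympl /=; parity.
rewrite E !H //; [by parity | distinct U..].
Qed.

(** The van Kampen obstruction of K_5. The sum is that of the symplectic products
    of all 15 pairs of independent edges. Every [u] term occurs twice in it; what
    is left is one crossing for each of the five 4-subsets of the vertices, an odd
    number. *)
Lemma K5_parity (a b c d f : V) :
  uniq [:: a; b; c; d; f] -> {in [:: a; b; c; d; f] &, forall x y, x != y -> e x y} ->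
  sympl (tri a b c) (tri a d f) (+) sympl (tri a b d) (tri a c f)
  (+) sympl (tri a b f) (tri a c d).
Proof.
case: huo => O H U C.
have E : sympl (tri a b c) (tri a d f) (+) sympl (tri a b d) (tri a c f)
  (+) sympl (tri a b f) (tri a c d) =
  (sympl (h a b) (h c d) (+) sympl (h a b) (h c f) (+) sympl (h a b) (h d f))
  (+) (sympl (h a c) (h b d) (+) sympl (h a c) (h b f) (+) sympl (h a c) (h d f))
  (+) (sympl (h a d) (h b c) (+) sympl (h a d) (h b f) (+) sympl (h a d) (h c f))
  (+) (sympl (h a f) (h b c) (+) sympl (h a f) (h b d) (+) sympl (h a f) (h c d))
  (+) (sympl (h b c) (h d f) (+) sympl (h b d) (h c f) (+) sympl (h b f) (h c d)).
  by rewrite /tri /add2 /sympl /=; parity.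
rewrite E !H; try by [distinct U |
  apply: C; rewrite ?inE ?eqxx ?orbT //; distinct U].
have [Oab Oac Oad Oaf] : [/\ o b a = ~~ o a b, o c a = ~~ o a c,
  o d a = ~~ o a d & o f a = ~~ o a f] by split; apply: O; distinct U.
have [Obc Obd Obf Ocd] : [/\ o c b = ~~ o b c, o d b = ~~ o b d,
  o f b = ~~ o b f & o d c = ~~ o c d] by split; apply: O; distinct U.
have [Ocf Odf] : o f c = ~~ o c f /\ o f d = ~~ o d f.
  by split; apply: O; distinct U.
rewrite Oab Oac Oad Oaf Obc Obd Obf Ocd Ocf Odf; parity.
Qed.

(** The analogue of [K5_parity] for K_{3,3}: its 18 pairs of independent edges
    give an odd number, here written as products of quadrilaterals that share
    the edge iv. *)
Lemma K33_parity (i j k s t v : V) :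
  uniq [:: i; j; k; s; t; v] ->
  {in [:: i; j; k] & [:: s; t; v], forall x y, e x y} ->
  sympl (quad i j s v) (quad i k t v) (+) sympl (quad i j t v) (quad i k s v).
Proof.
case: huo => O H U C.
have E : sympl (quad i j s v) (quad i k t v) (+)
    sympl (quad i j t v) (quad i k s v) =
  (sympl (h i s) (h j t) (+) sympl (h i s) (h j v) (+)
   sympl (h i t) (h j s) (+) sympl (h i t) (h j v) (+)
   sympl (h i v) (h j s) (+) sympl (h i v) (h j t)) (+)
  (sympl (h i s) (h k t) (+) sympl (h i s) (h k v) (+)
   sympl (h i t) (h k s) (+) sympl (h i t) (h k v) (+)
   sympl (h i v) (h k s) (+) sympl (h i v) (h k t)) (+)
  (sympl (h j s) (h k t) (+) sympl (h j s) (h k v) (+)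
   sympl (h j t) (h k s) (+) sympl (h j t) (h k v) (+)
   sympl (h j v) (h k s) (+) sympl (h j v) (h k t)).
  by rewrite /quad /add2 /sympl /=; parity.
rewrite E !H; try by [distinct U | apply: C; rewrite !inE ?eqxx ?orbT].
have [Oij Oik Ojk] : [/\ o j i = ~~ o i j, o k i = ~~ o i k &
  o k j = ~~ o j k] by split; apply: O; distinct U.
have [Ost Osv Otv] : [/\ o t s = ~~ o s t, o v s = ~~ o s v &
  o v t = ~~ o t v] by split; apply: O; distinct U.
rewrite Oij Oik Ojk Ost Osv Otv; parity.
Qed.

End ParityData.

Section Obstructions.
Variables (V : eqType) (e : rel V) (h : V -> V -> F22).
Variables (u : V -> V -> V -> bool) (o : rel V).
Hypothesis huo : parity_data e h u o.

(** Otherwise the triangles of the K_5 on the five other vertices would all be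
    orthogonal to the same nonzero class, hence to one another. *)
Lemma K8_tri0 (a b c d f g i j : V) :
  uniq [:: a; b; c; d; f; g; i; j] ->
  {in [:: a; b; c; d; f; g; i; j] &, forall x y, x != y -> e x y} ->
  tri h a b c = (false, false).
Proof.
move=> U C; apply/eqP; apply: contraT => abc0.
have := K5_parity huo (a := d) (b := f) (c := g) (d := i) (f := j).
have O x y z : uniq [:: a; b; c; x; y; z] ->
    {subset [:: x; y; z] <= [:: d; f; g; i; j]} ->
    sympl (tri h a b c) (tri h x y z) = false.
  move=> U' sub.
  have sub' w : w \in [:: x; y; z] -> w \in [:: a; b; c; d; f; g; i; j].
    by move/sub; rewrite (mem_cat w [:: a; b; c] [:: d; f; g; i; j]) orbC => ->.
  apply: (tri_tri huo) => //; apply: C; try by [distinct U'];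
  by [rewrite !inE eqxx ?orbT | apply: sub'; rewrite !inE eqxx ?orbT].
have S x y z x' y' z' : uniq [:: a; b; c; x; y; z] ->
    {subset [:: x; y; z] <= [:: d; f; g; i; j]} ->
    uniq [:: a; b; c; x'; y'; z'] ->
    {subset [:: x'; y'; z'] <= [:: d; f; g; i; j]} ->
    sympl (tri h x y z) (tri h x' y' z') = false.
  by move=> *; apply: (sympl_orthogonal1 abc0); apply: O.
rewrite !S; try by [distinct U |
  move=> w; rewrite !inE; do ?[case/orP]; move=> /eqP->; rewrite eqxx ?orbT].
rewrite /=; apply; first by distinct U.
by move=> x y xi yi; apply: C; rewrite (mem_cat _ [:: a; b; c]) ?xi ?yi orbT.
Qed.

Lemma no_parity_data_K8 (v : 'I_8 -> V) :
  injective v -> (forall i j, i != j -> e (v i) (v j)) -> False.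
Proof.
move=> vI C.
have K s : uniq s -> uniq (map v s) by rewrite map_inj_uniq.
have C' (s : seq 'I_8) : {in map v s &, forall x y, x != y -> e x y}.
  move=> _ _ /mapP[x _ ->] /mapP[y _ ->] xy; apply: C.
  by apply: contra_neq xy => ->.
pose w k := v (inord k : 'I_8).
have T k l m n p q r t : uniq [:: k; l; m; n; p; q; r; t] ->
    all (fun i => i < 8)%N [:: k; l; m; n; p; q; r; t] ->
    tri h (w k) (w l) (w m) = (false, false).
  move=> U A.
  apply: (@K8_tri0 _ _ _ (w n) (w p) (w q) (w r) (w t)).
    apply: (K (map (inord : nat -> 'I_8) [:: k; l; m; n; p; q; r; t])).
    rewrite map_inj_in_uniq // => x y /(allP A) x8 /(allP A) y8.
    by move/(congr1 (@nat_of_ord _)); rewrite !inordK.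
  exact: (C' (map (inord : nat -> 'I_8) [:: k; l; m; n; p; q; r; t])).
have := @K5_parity _ _ _ _ _ huo (w 0) (w 1) (w 2) (w 3) (w 4).
rewrite (T 0 1 2 3 4 5 6 7)%N // (T 0 1 3 2 4 5 6 7)%N //.
rewrite (T 0 1 4 2 3 5 6 7)%N // => k; suff: false by [].
apply: k.
  apply: (K (map (inord : nat -> 'I_8) [:: 0; 1; 2; 3; 4]%N)).
  by rewrite map_inj_in_uniq // => x y; rewrite !inE;
    do ?[case/orP]; move=> /eqP->; do ?[case/orP]; move=> /eqP-> //;
    move/(congr1 (@nat_of_ord _)); rewrite !inordK.
exact: (C' (map (inord : nat -> 'I_8) [:: 0; 1; 2; 3; 4]%N)).
Qed.

(** If the quadrilaterals [m c a v] and [m d b v] had product 1, their classes would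
    span the plane. By [sympl_orthogonal1] the quadrilaterals on [x, c] (disjoint
    from the second) are pairwise orthogonal, and so are those on [x, d]; K_{3,3}
    on [x, c, d] and [s, t, r] then makes two classes on [c, d] independent. The
    quadrilaterals on [x, m] and [a, b, v] are orthogonal to both of them, so
    vanish, against K_{3,3} on [x, m, c] and [a, b, v]. *)
Lemma K46_aux (x m c d a b v s t r : V) :
  uniq [:: x; m; c; d; a; b; v; s; t; r] ->
  {in [:: x; m; c; d] & [:: a; b; v; s; t; r], forall y z, e y z} ->
  sympl (quad h m c a v) (quad h m d b v) = false.
Proof.
move=> U C; apply/negP => pq; have [p0 q0] := sympl_neq0 pq.
have Q i j k l y z y' z' : uniq [:: i; j; y; z; k; l; y'; z'] ->
    {subset [:: i; j; k; l] <= [:: x; m; c; d]} ->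
    {subset [:: y; z; y'; z'] <= [:: a; b; v; s; t; r]} ->
    sympl (quad h i j y z) (quad h k l y' z') = false.
  move=> U' s1 s2; apply: (quad_quad huo) => //; apply: C;
  by [apply: s1; rewrite !inE eqxx ?orbT | apply: s2; rewrite !inE eqxx ?orbT].
have K i j k y z w : uniq [:: i; j; k; y; z; w] ->
    {subset [:: i; j; k] <= [:: x; m; c; d]} ->
    {subset [:: y; z; w] <= [:: a; b; v; s; t; r]} ->
    sympl (quad h i j y w) (quad h i k z w) (+)
    sympl (quad h i j z w) (quad h i k y w).
  by move=> U' s1 s2; apply: (K33_parity huo) => // ? ? /s1 ? /s2 ?; apply: C.
have cc : sympl (quad h x c s r) (quad h x c t r) = false.
  by apply: (sympl_orthogonal1 q0); apply: Q;
  [distinct U|sublist|sublist|distinct U|sublist|sublist].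
have dd : sympl (quad h x d s r) (quad h x d t r) = false.
  by apply: (sympl_orthogonal1 p0); apply: Q;
  [distinct U|sublist|sublist|distinct U|sublist|sublist].
have cd : sympl (quad h c d s r) (quad h c d t r).
  have /= k := K x c d s t r.
  have -> : sympl (quad h c d s r) (quad h c d t r) =
    sympl (quad h x c s r) (quad h x c t r) (+)
    sympl (quad h x d s r) (quad h x d t r) (+)
    (sympl (quad h x c s r) (quad h x d t r) (+)
     sympl (quad h x c t r) (quad h x d s r)).
    by rewrite /quad /sympl /add2 /=; parity.
  by rewrite cc dd; apply: k; [distinct U|sublist|sublist].
have xa y : y \in [:: a; b] -> quad h x m y v = (false, false).
  rewrite !inE => yab; case/orP: yab => /eqP->; apply: (sympl_orthogonal2 cd);
  by apply: Q; [distinct U|sublist|sublist].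
have := K x m c a b v; rewrite !xa ?inE ?eqxx ?orbT // => k; suff: false by [].
by apply: k; [distinct U|sublist|sublist].
Qed.

Lemma no_parity_data_K46 (v : 'I_4 -> V) (w : 'I_6 -> V) :
  injective v -> injective w -> (forall i j, v i != w j) ->
  (forall i j, e (v i) (w j)) -> False.
Proof.
move=> vI wI D C.
pose x k := v (inord k : 'I_4); pose y k := w (inord k : 'I_6).
have xI k l : (k < 4)%N -> (l < 4)%N -> (x k == x l) = (k == l).
  by move=> k4 l4; rewrite (inj_eq vI) -val_eqE /= !inordK.
have yI k l : (k < 6)%N -> (l < 6)%N -> (y k == y l) = (k == l).
  by move=> k4 l4; rewrite (inj_eq wI) -val_eqE /= !inordK.
have A a b : uniq [:: a; b; 2; 3; 4; 5]%N -> (a < 2)%N -> (b < 2)%N ->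
    sympl (quad h (x 0%N) (x 1%N) (y a) (y 2%N)) (quad h (x 0%N) (x 2%N) (y b) (y 2%N))
     = false.
  move=> U a2 b2; apply: (@K46_aux (x 3%N) _ _ _ _ _ _ (y 3%N) (y 4%N) (y 5%N)).
    have a6 : (a < 6)%N by lia. have b6 : (b < 6)%N by lia.
    by rewrite /= !inE !xI // !yI //= ?(negPf (D _ _)) //=;
      move: U; rewrite /= !inE.
  move=> ? ?; rewrite !inE; do ?[case/orP]; move=> /eqP->;
  by do ?[case/orP]; move=> /eqP->; apply: C.
have := K33_parity huo (i := x 0%N) (j := x 1%N) (k := x 2%N)
  (s := y 0%N) (t := y 1%N) (v := y 2%N).
rewrite !A // => k; suff: false by [].
apply: k.
  by rewrite /= !inE !xI // !yI //= ?(negPf (D _ _)).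
move=> ? ?; rewrite !inE; do ?[case/orP]; move=> /eqP->;
by do ?[case/orP]; move=> /eqP->; apply: C.
Qed.

Lemma no_planar_parity_data_K5 (v : 'I_5 -> V) :
  injective v -> (forall i j, i != j -> e (v i) (v j)) ->
  (forall a b, h a b = (false, false)) -> False.
Proof.
move=> vI C h0; pose w k := v (inord k : 'I_5).
have wI k l : (k < 5)%N -> (l < 5)%N -> (w k == w l) = (k == l).
  by move=> k4 l4; rewrite (inj_eq vI) -val_eqE /= !inordK.
have := K5_parity huo (a := w 0%N) (b := w 1%N) (c := w 2%N) (d := w 3%N)
  (f := w 4%N).
rewrite /tri !h0 => k; suff: false by [].
apply: k; first by rewrite /= !inE !wI.
move=> x y; move=> xm ym.
have: x \in map v (map (inord : nat -> 'I_5) [:: 0; 1; 2; 3; 4]%N) by [].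
have: y \in map v (map (inord : nat -> 'I_5) [:: 0; 1; 2; 3; 4]%N) by [].
case/mapP=> y' _ -> /mapP[x' _ ->] ne; apply: C.
by apply: contra_neq ne => ->.
Qed.

Lemma no_planar_parity_data_K33 (v w : 'I_3 -> V) :
  injective v -> injective w -> (forall i j, v i != w j) ->
  (forall i j, e (v i) (w j)) ->
  (forall a b, h a b = (false, false)) -> False.
Proof.
move=> vI wI D C h0; pose x k := v (inord k : 'I_3); pose y k := w (inord k : 'I_3).
have xI k l : (k < 3)%N -> (l < 3)%N -> (x k == x l) = (k == l).
  by move=> k4 l4; rewrite (inj_eq vI) -val_eqE /= !inordK.
have yI k l : (k < 3)%N -> (l < 3)%N -> (y k == y l) = (k == l).
  by move=> k4 l4; rewrite (inj_eq wI) -val_eqE /= !inordK.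
have := K33_parity huo (i := x 0%N) (j := x 1%N) (k := x 2%N)
  (s := y 0%N) (t := y 1%N) (v := y 2%N).
rewrite /quad !h0 => k; suff: false by [].
apply: k.
  by rewrite /= !inE !xI // !yI //= ?(negPf (D _ _)).
move=> ? ?; rewrite !inE; do ?[case/orP]; move=> /eqP->;
by do ?[case/orP]; move=> /eqP->; apply: C.
Qed.

End Obstructions.

(** * Counting crossings of sampled paths *)

Section Crossings.
Variable K : realType.
Local Open Scope ring_scope.
Implicit Types (p q r : K * K) (a b c d : K).

(** Distance on the circle R/Z, for representatives in [0, 1). *)
Definition circ a b : K := Num.min `|a - b| (1 - `|a - b|).

(** A short step between [a] and [b] passes through 0 = 1 exactly when they are more
    than half a turn apart as real numbers. *)
Definition jump a b : bool := 1 / 2 < `|a - b|.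

(** Ties are broken by the other coordinate, so that distinct points are always
    comparable and no general position is needed. *)
Definition right_of p q : bool :=
  (q.1 < p.1) || ((q.1 == p.1) && (q.2 < p.2)).

Definition above p q : bool :=
  (q.2 < p.2) || ((q.2 == p.2) && (q.1 < p.1)).

Lemma circC a b : circ a b = circ b a.
Proof. by rewrite /circ distrC. Qed.

Lemma circ_cases a b : circ a b = `|a - b| \/ circ a b = 1 - `|a - b|.
Proof. by rewrite /circ minEle; case: ifP; [left | right]. Qed.

Lemma circ_triangle a b c : 0 <= a < 1 -> 0 <= b < 1 -> 0 <= c < 1 ->
  circ a c <= circ a b + circ b c.
Proof.
move=> /andP[? ?] /andP[? ?] /andP[? ?]; rewrite leNgt; apply/negP.
rewrite {3}/circ lt_min => /andP[].
case: (circ_cases a b) (circ_cases b c) => -> [] ->;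
by case: (ger0P (a - c)); case: (ger0P (a - b)); case: (ger0P (b - c));
  move=> *; lra.
Qed.

Lemma circ_eq0 a b : 0 <= a < 1 -> 0 <= b < 1 -> circ a b <= 0 -> a = b.
Proof.
move=> /andP[? ?] /andP[? ?]; rewrite /circ ge_min => /orP[|].
  by rewrite normr_le0 subr_eq0 => /eqP.
by case: (ger0P (a - b)) => ? ?; lra.
Qed.

Lemma circ_ge0 a b : 0 <= a < 1 -> 0 <= b < 1 -> 0 <= circ a b.
Proof.
move=> /andP[? ?] /andP[? ?]; rewrite /circ le_min normr_ge0 /=.
by case: (ger0P (a - b)) => ?; lra.
Qed.

(** On the circle a short step far from [b] passes [b] in the order of [0, 1) only
    by passing 0. *)
Lemma lt_far a a' b (t : K) : 0 <= a < 1 -> 0 <= a' < 1 -> 0 <= b < 1 ->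
  circ a a' <= t -> t < circ a b ->
  [/\ a != b, a' != b & (b < a) (+) (b < a') = jump a a'].
Proof.
move=> /andP[? ?] /andP[? ?] /andP[? ?]; rewrite /circ /jump lt_min ge_min.
move=> near /andP[f1 f2].
have ab : a != b.
  by apply/eqP => ab; move: near f1 f2; rewrite ab subrr normr0;
    case: (ger0P (b - a')) => ? /orP[] *; lra.
have a'b : a' != b.
  by apply/eqP => ab'; move: near f1 f2; rewrite ab';
    case: (ger0P (a - b)) => ? /orP[] *; lra.
split=> //; move: near f1 f2.
case: (ltgtP a b) ab => // lab _; case: (ltgtP a' b) a'b => // lab' _ /=.
all: case: (ger0P (a - b)) => ?; case: (ger0P (a - a')) => ? /orP[] ? ? ?.
all: apply/esym; try (apply/negbTE; rewrite -leNgt); lra.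
Qed.

Definition torus_pt p : bool := (0 <= p.1 < 1) && (0 <= p.2 < 1).

Definition near_pts (t : K) p q : bool := (circ p.1 q.1 <= t) && (circ p.2 q.2 <= t).

Definition far_pts (t : K) p q : bool := (t < circ p.1 q.1) || (t < circ p.2 q.2).

Lemma right_ofN p q : p != q -> right_of p q = ~~ right_of q p.
Proof.
case: p q => [a b] [c d]; rewrite xpair_eqE /right_of /=.
by case: (ltgtP a c) => //= _; case: (ltgtP b d).
Qed.

Lemma aboveN p q : p != q -> above p q = ~~ above q p.
Proof.
case: p q => [a b] [c d]; rewrite xpair_eqE /above /=.
by case: (ltgtP b d) => //=; rewrite ?andbF // andbT => _; case: (ltgtP a c).
Qed.

(** Parity of the crossings of the step from [p] to [p'] with the ray of [q], which
    goes up from [q] to the line y = 1 and then right to the corner. The first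
    summand counts the passages over [q], where a change of [right_of] due
    to a wrap is discarded; the second one counts the passage through the horizontal
    part. The step is made horizontally first: the value of [above] is read before it,
    that of [right_of] after it. *)
Definition sweep p p' q : bool :=
  (right_of p q (+) right_of p' q (+) jump p.1 p'.1) && above p q
  (+) (jump p.2 p'.2 && right_of p' q).

(** Parity of the passages of the ray over [p] while its origin moves from [q] to
    [q'], up to the horizontal or vertical circle that a wrap of [q] adds to the ray. *)
Definition sweep_by p q q' : bool :=
  (right_of p q (+) right_of p q' (+) jump q.1 q'.1) && above p q
  (+) (jump q.2 q'.2 && right_of p q').

(** Exchanging the roles of the two points replaces the ray going up by the opposite
    one; together they form a full vertical line. *)
Lemma sweep_byE p q q' : p != q -> p != q' ->
  sweep_by p q q' = sweep q q' p (+) right_of q p (+) right_of q' p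
    (+) jump q.1 q'.1 (+) jump q.2 q'.2.
Proof.
move=> pq pq'; rewrite /sweep_by /sweep (right_ofN pq) (right_ofN pq') (aboveN pq).
parity.
Qed.

Lemma pass_far (t : K) p p' q : torus_pt p -> torus_pt p' -> torus_pt q ->
  circ p.1 p'.1 <= t -> t < circ p.1 q.1 ->
  right_of p q (+) right_of p' q (+) jump p.1 p'.1 = false.
Proof.
move=> /andP[p1 _] /andP[p1' _] /andP[q1 _] near far.
have [pq p'q <-] := lt_far p1 p1' q1 near far.
rewrite /right_of ![q.1 == _]eq_sym (negPf pq) (negPf p'q) /= !orbF.
exact: addbb.
Qed.

Lemma pass_by_far (t : K) p q q' : torus_pt p -> torus_pt q -> torus_pt q' ->
  circ q.1 q'.1 <= t -> t < circ p.1 q.1 ->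
  right_of p q (+) right_of p q' (+) jump q.1 q'.1 = false.
Proof.
move=> pT qT qT' near; rewrite circC => far.
have := pass_far qT qT' pT near far.
case/andP: (pT) (qT) (qT') => p1 _ /andP[q1 _] /andP[q1' _].
have [qp q'p _] := lt_far q1 q1' p1 near far.
have pq : p != q by apply: contra_neq qp => ->.
have pq' : p != q' by apply: contra_neq q'p => ->.
by rewrite (right_ofN pq) (right_ofN pq') => <-; parity.
Qed.

Lemma above_far (t : K) p p' q : torus_pt p -> torus_pt p' -> torus_pt q ->
  circ p.2 p'.2 <= t -> t < circ p.2 q.2 ->
  above p' q = above p q (+) jump p.2 p'.2.
Proof.
move=> /andP[_ p2] /andP[_ p2'] /andP[_ q2] near far.
have [pq p'q <-] := lt_far p2 p2' q2 near far.
rewrite /above ![q.2 == _]eq_sym (negPf pq) (negPf p'q) /= !orbF; parity.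
Qed.

Lemma above_by_far (t : K) p q q' : torus_pt p -> torus_pt q -> torus_pt q' ->
  circ q.2 q'.2 <= t -> t < circ p.2 q.2 ->
  above p q' = above p q (+) jump q.2 q'.2.
Proof.
move=> pT qT qT' near; rewrite circC => far.
have := above_far qT qT' pT near far.
case/andP: (pT) (qT) (qT') => _ p2 /andP[_ q2] /andP[_ q2'].
have [qp q'p _] := lt_far q2 q2' p2 near far.
have pq : p != q by apply: contra_neq qp => ->.
have pq' : p != q' by apply: contra_neq q'p => ->.
by rewrite (aboveN pq) (aboveN pq') => ->; parity.
Qed.

(** If both points make a short step while staying away from each other, then going
    around the square of positions changes nothing but for the wraps: a wrap of one
    point makes the ray sweep a full circle, which meets the wraps of the other point
    in the other direction. *)
Lemma sweep_cell (t : K) p p' q q' :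
  torus_pt p -> torus_pt p' -> torus_pt q -> torus_pt q' ->
  near_pts t p p' -> near_pts t q q' -> far_pts (t + t) p q ->
  sweep p p' q (+) sweep p p' q' (+) sweep_by p q q' (+) sweep_by p' q q' =
  (jump p.1 p'.1 && jump q.2 q'.2) (+) (jump p.2 p'.2 && jump q.1 q'.1).
Proof.
move=> pT p'T qT q'T /andP[np1 np2] /andP[nq1 nq2] far.
case/andP: (pT) (p'T) (qT) (q'T) => p1 p2 /andP[p1' p2'] /andP[q1 q2] /andP[q1' q2'].
(* P and P' are the passages of p at q and q', Q and Q' those of q at p and p' *)
set P := right_of p q (+) right_of p' q (+) jump p.1 p'.1.
set P' := right_of p q' (+) right_of p' q' (+) jump p.1 p'.1.
set Q := right_of p q (+) right_of p q' (+) jump q.1 q'.1.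
set Q' := right_of p' q (+) right_of p' q' (+) jump q.1 q'.1.
suff X : (P (+) Q) && above p q (+)
    P' && (above p q' (+) jump q.2 q'.2) (+)
    Q' && (above p' q (+) jump p.2 p'.2) = false.
  apply: (parity_from X); rewrite /sweep /sweep_by /P /P' /Q /Q'; parity.
have t0 : 0 <= t by apply: le_trans np1; exact: circ_ge0.
(* a passage needs close abscissas, and then the points are far in height *)
have [far1|far1] := ltP (t + t) (circ p.1 q.1).
  have -> : P = false by apply: pass_far np1 _ => //; lra.
  have -> : Q = false by apply: pass_by_far nq1 _ => //; lra.
  have -> : P' = false.
    apply: pass_far np1 _ => //; have := circ_triangle p1 q1' q1.
    by rewrite (circC q'.1); lra.
  have -> // : Q' = false.
    apply: pass_by_far nq1 _ => //; have := circ_triangle p1 p1' q1; lra.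
have far2 : t + t < circ p.2 q.2 by move: far; rewrite /far_pts ltNge far1.
have lt_t : t < circ p.2 q.2 by lra.
rewrite (above_by_far pT qT q'T nq2 lt_t) (above_far pT p'T qT np2 lt_t).
have -> : above p q (+) jump q.2 q'.2 (+) jump q.2 q'.2 = above p q by parity.
have -> : above p q (+) jump p.2 p'.2 (+) jump p.2 p'.2 = above p q by parity.
rewrite /P /P' /Q /Q'; parity.
Qed.

Definition holonomy (w : nat -> K * K) n : F22 :=
  (\big[addb/false]_(i < n) jump (w i).1 (w i.+1).1,
   \big[addb/false]_(i < n) jump (w i).2 (w i.+1).2).

Definition sweeps (w : nat -> K * K) n q : bool :=
  \big[addb/false]_(i < n) sweep (w i) (w i.+1) q.

Definition sweeps_by p (w : nat -> K * K) n : bool :=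
  \big[addb/false]_(i < n) sweep_by p (w i) (w i.+1).

Lemma sweeps_byE p (w : nat -> K * K) n :
  (forall i, (i <= n)%N -> p != w i) ->
  sweeps_by p w n = sweeps w n p (+) right_of (w 0%N) p (+) right_of (w n) p
    (+) (holonomy w n).1 (+) (holonomy w n).2.
Proof.
rewrite /sweeps_by /sweeps /holonomy /=; elim: n => [|n IHn] H.
  by rewrite !big_ord0; parity.
rewrite !big_ord_recr /= IHn => [|i /leqW]; last exact: H.
rewrite sweep_byE ?H //; parity.
Qed.

(** Summation of [sweep_cell] over the grid of pairs of samples: only the four sides
    of the rectangle survive. *)
Lemma sympl_holonomy (t : K) (w z : nat -> K * K) m n :
  (forall i, torus_pt (w i)) -> (forall i, torus_pt (z i)) ->
  (forall i, (i < m)%N -> near_pts t (w i) (w i.+1)) ->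
  (forall j, (j < n)%N -> near_pts t (z j) (z j.+1)) ->
  (forall i j, (i <= m)%N -> (j <= n)%N -> far_pts (t + t) (w i) (z j)) ->
  sympl (holonomy w m) (holonomy z n) =
    sweeps w m (z 0%N) (+) sweeps w m (z n)
    (+) sweeps_by (w 0%N) z n (+) sweeps_by (w m) z n.
Proof.
move=> wT zT wN zN far.
have strip j k : (j < n)%N -> (k <= m)%N ->
    sweeps w k (z j) (+) sweeps w k (z j.+1) (+)
    sweep_by (w 0%N) (z j) (z j.+1) (+) sweep_by (w k) (z j) (z j.+1) =
    ((holonomy w k).1 && jump (z j).2 (z j.+1).2) (+)
    ((holonomy w k).2 && jump (z j).1 (z j.+1).1).
  move=> jn; rewrite /sweeps /holonomy /=; elim: k => [|k IHk] km.
    by rewrite !big_ord0; parity.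
  have C := sweep_cell (wT k) (wT k.+1) (zT j) (zT j.+1) (wN _ km) (zN _ jn)
    (far _ _ (ltnW km) (ltnW jn)).
  rewrite !big_ord_recr /=; apply: (parity_from (IHk (ltnW km))).
  apply: (parity_from C); parity.
suff H k : (k <= n)%N ->
    sweeps w m (z 0%N) (+) sweeps w m (z k)
    (+) sweeps_by (w 0%N) z k (+) sweeps_by (w m) z k =
    sympl (holonomy w m) (holonomy z k) by rewrite H.
elim: k => [_|k IHk kn].
  by rewrite /sweeps_by /sympl /holonomy /= !big_ord0; parity.
apply: (parity_from (IHk (ltnW kn))); apply: (parity_from (strip _ _ kn (leqnn m))).
rewrite /sweeps_by /sympl /holonomy /= !big_ord_recr /=; parity.
Qed.
End Crossings.

(** * Sampling a drawing *)

Section Sampling.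
Variable K : realType.
Local Open Scope ring_scope.
Local Open Scope classical_set_scope.

(** Continuity of a path in the circle R/Z, written on representatives in [0, 1). *)
Definition circ_path (f : K -> K) : Prop :=
  (forall s, 0 <= s <= 1 -> 0 <= f s < 1) /\
  (forall s e : K, 0 <= s <= 1 -> 0 < e ->
     \forall t \near s, 0 <= t <= 1 -> circ (f s) (f t) < e).

Lemma circ_path_uniform (f : K -> K) (e : K) : circ_path f -> 0 < e ->
  \forall n \near \oo, forall s t, 0 <= s <= 1 -> 0 <= t <= 1 ->
    `|s - t| <= n.+1%:R^-1 -> circ (f s) (f t) <= e.
Proof.
case=> f01 fc e0.
have /compact_near_coveringP cK := @segment_compact K 0 1.
have := cK nat \oo (fun n s => 0 <= s <= 1 -> forall t, 0 <= t <= 1 ->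
    `|s - t| <= n.+1%:R^-1 -> circ (f s) (f t) <= e) _.
case=> [s0|N _ H].
  rewrite /= in_itv /= => s01.
  have e20 : 0 < e / 2 by lra.
  have /nbhs_ballP[r /= r0 Hr] := fc s0 (e / 2) s01 e20.
  have r20 : 0 < r / 2 by lra.
  near=> s n => /= sI t tI st.
  have ss0 : `|s0 - s| < r / 2.
    by near: s; apply/nbhs_ballP; exists (r / 2) => //= w; rewrite -ball_normE.
  have nr : n.+1%:R^-1 < r / 2.
    by near: n; exact: near_infty_natSinv_lt (PosNum r20).
  have := Hr s; have := Hr t; rewrite -ball_normE /ball_ /= => H1 H2.
  have {}H2 : circ (f s0) (f s) < e / 2
    by apply: H2 sI; apply: lt_trans ss0 _; rewrite ltr_pdivrMr ?ltr_pMr ?ltr1n.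
  have {}H1 : circ (f s0) (f t) < e / 2.
    apply: H1 => //; apply: le_lt_trans (ler_distD s _ _) _.
    by rewrite [r]splitr ltrD // (le_lt_trans st).
  have := circ_triangle (f01 _ sI) (f01 _ s01) (f01 _ tI).
  by rewrite (circC (f s) (f s0)); lra.
exists N => // n Nn s t sI tI; apply: H => //=; by rewrite in_itv.
Unshelve. all: by end_near. Qed.

(** Two disjoint compact paths on the torus are at positive distance. *)
Lemma circ_path_far (f g f' g' : K -> K) :
  circ_path f -> circ_path g -> circ_path f' -> circ_path g' ->
  (forall s t, 0 <= s <= 1 -> 0 <= t <= 1 -> ~ (f s = f' t /\ g s = g' t)) ->
  \forall n \near \oo, forall s t, 0 <= s <= 1 -> 0 <= t <= 1 ->
    far_pts (n.+1%:R^-1 + n.+1%:R^-1) (f s, g s) (f' t, g' t).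
Proof.
case=> f01 fc [g01 gc] [f01' fc'] [g01' gc'] dis.
have /compact_near_coveringP cK :=
  compact_setX (@segment_compact K 0 1) (@segment_compact K 0 1).
have := cK nat \oo (fun n st => 0 <= st.1 <= 1 -> 0 <= st.2 <= 1 ->
   far_pts (n.+1%:R^-1 + n.+1%:R^-1) (f st.1, g st.1) (f' st.2, g' st.2)) _.
case=> [[s0 t0]|N _ H].
  rewrite /= !in_itv /= => -[s01 t01].
  have near_far (h h' : K -> K) : circ_path h -> circ_path h' ->
      h s0 <> h' t0 -> \forall s \near (s0, t0) & n \near \oo,
      0 <= s.1 <= 1 -> 0 <= s.2 <= 1 -> n.+1%:R^-1 + n.+1%:R^-1 < circ (h s.1) (h' s.2).
    case=> h01 hc [h01' hc'] ne.
    have c0 : 0 < circ (h s0) (h' t0).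
      by rewrite ltNge; apply/negP => /(circ_eq0 (h01 _ s01) (h01' _ t01)).
    pose c := circ (h s0) (h' t0); have c4 : 0 < c / 4 by rewrite /c; lra.
    have c8 : 0 < c / 8 by rewrite /c; lra.
    have N1 : \forall st \near (s0, t0), 0 <= st.1 <= 1 ->
        circ (h s0) (h st.1) < c / 4 by exact: (cvg_fst (hc _ _ s01 c4)).
    have N2 : \forall st \near (s0, t0), 0 <= st.2 <= 1 ->
        circ (h' t0) (h' st.2) < c / 4 by exact: (cvg_snd (hc' _ _ t01 c4)).
    have aux (a b d e n c1 : K) : 0 < c1 -> a < c1 / 4 -> b < c1 / 4 -> n < c1 / 8 ->
      d <= e + b -> c1 <= a + d -> n + n < e by clear; move=> *; lra.
    near=> st n => /= sI tI.
    have H1 : circ (h s0) (h st.1) < c / 4 by move: sI; near: st.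
    have H2 : circ (h' t0) (h' st.2) < c / 4 by move: tI; near: st.
    have nr : n.+1%:R^-1 < c / 8.
      by near: n; exact: near_infty_natSinv_lt (PosNum c8).
    have := circ_triangle (h01 _ s01) (h01 _ sI) (h01' _ t01).
    have := circ_triangle (h01 _ sI) (h01' _ tI) (h01' _ t01).
    rewrite (circC (h' st.2)); exact: (aux _ _ _ _ _ _ c0 H1 H2 nr).
  have [fe|/eqP fe] := eqVneq (f s0) (f' t0).
    have [ge|/eqP ge] := eqVneq (g s0) (g' t0); first by case: (dis s0 t0).
    have := near_far g g' (conj g01 gc) (conj g01' gc') ge.
    apply: filterS => -[st n] /= H sI tI; apply/orP; right; exact: H.
  have := near_far f f' (conj f01 fc) (conj f01' fc') fe.
  by apply: filterS => -[st n] /= H sI tI; apply/orP; left; exact: H.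
exists N => // n Nn s t sI tI; apply: (H n Nn (s, t)) => //=; by rewrite !in_itv.
Unshelve. all: by end_near.
Qed.
End Sampling.

Section DrawingParity.
Variables (K : realType) (G : sgraph).
Local Open Scope ring_scope.
Local Open Scope classical_set_scope.
Local Notation space := (K * K * K)%type.
Variables (S W : set space) (pt : G -> space) (arc : {set G} -> K -> space).
Hypothesis D : drawing S pt arc.

Definition circ_continuous (f : space -> K) : Prop :=
  forall P, W P -> forall e : K, 0 < e ->
    \forall Q \near P, W Q -> circ (f P) (f Q) < e.

Lemma circ_path_arc (f : space -> K) (E : {set G}) :
  (forall P, W P -> 0 <= f P < 1) -> circ_continuous f ->
  E \in edges G -> arc E @` `[0, 1] `<=` W -> circ_path (f \o arc E).
Proof.
move=> f01 fc EG EW.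
have EW' s : 0 <= s <= 1 -> W (arc E s).
  by move=> sI; apply: EW; exists s => //=; rewrite in_itv.
split=> [s sI|s e sI e0]; first exact: (f01 (arc E s) (EW' s sI)).
have /subspace_continuousP/(_ s) := drawing_arc_cont D EG.
rewrite /= in_itv /= => /(_ sI) c.
have h : \forall t \near s, `[0, 1] t -> W (arc E t) ->
    circ (f (arc E s)) (f (arc E t)) < e := c _ (fc _ (EW' _ sI) _ e0).
apply: filterS h => t H tI.
by apply: H; [rewrite /= in_itv | exact: EW'].
Qed.

Lemma edge_set2 (a b : G) : adj a b -> [set a; b]%SET \in edges G.
Proof.
by move=> ab; rewrite inE; apply/existsP; exists a; apply/existsP; exists b;
  rewrite ab eqxx.
Qed.

Lemma arc_endpoints (a b : G) : adj a b ->
  (arc [set a; b]%SET 0 = pt a /\ arc [set a; b]%SET 1 = pt b) \/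
  (arc [set a; b]%SET 0 = pt b /\ arc [set a; b]%SET 1 = pt a).
Proof.
move=> ab; have E := edge_set2 ab; have ends := drawing_arc_ends D E.
have ne : pt a <> pt b.
  by move/(drawing_pt_inj D) => ab'; move: ab; rewrite ab' adj_irr.
have endE s : (s = 0 \/ s = 1) ->
    arc [set a; b]%SET s = pt a \/ arc [set a; b]%SET s = pt b.
  move=> s01; have : (pt @` [set` [set a; b]%SET]) (arc [set a; b]%SET s).
    by rewrite -ends; case: s01 => ->; [left | right].
  by case=> v /=; rewrite !inE => /orP[] /eqP-> <-; [left | right].
have /= mem v : v \in [set a; b]%SET ->
    pt v = arc [set a; b]%SET 0 \/ pt v = arc [set a; b]%SET 1.
  move=> vab; have : (pt @` [set` [set a; b]%SET]) (pt v) by exists v.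
  by rewrite -ends => -[|] ->; [left | right].
have ma := mem a (set21 _ _); have mb := mem b (set22 _ _).
case: (endE 0 (or_introl erefl)) (endE 1 (or_intror erefl)) => e0 [] e1;
  [|by left|by right|].
  by case: mb => e; case: ne; rewrite -e0 -?e1 e ?e0 ?e1.
by case: ma => e; case: ne; rewrite -e0 -?e1 e ?e0 ?e1.
Qed.

Lemma arcs_disjoint (a b c d : G) (s t : K) :
  uniq [:: a; b; c; d] -> adj a b -> adj c d -> 0 <= s <= 1 -> 0 <= t <= 1 ->
  arc [set a; b]%SET s <> arc [set c; d]%SET t.
Proof.
move=> U ab cd sI tI e.
have open01 r : 0 <= r <= 1 -> [\/ r = 0, r = 1 | `]0, 1[ r].
  rewrite /= in_itv /= => /andP[]; rewrite !le_eqVlt.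
  case/orP=> [/eqP <-|r0]; first by constructor 1.
  by case/orP=> [/eqP ->|r1]; [constructor 2 | constructor 3; rewrite r0].
have bdry x y r : adj x y -> 0 <= r <= 1 ->
    arc [set x; y]%SET r = pt x \/ arc [set x; y]%SET r = pt y \/ `]0, 1[ r.
  move=> xy /open01[->|->|]; last by right; right.
    by case: (arc_endpoints xy) => -[-> _]; [left | right; left].
  by case: (arc_endpoints xy) => -[_ ->]; [right; left | left].
have inner x y r v : adj x y -> `]0, 1[ r -> arc [set x; y]%SET r <> pt v.
  move=> xy ro ev; apply: (drawing_arc_pt D (edge_set2 xy) (v := v)).
  by exists r.
have V x y : arc [set a; b]%SET s = pt x -> arc [set c; d]%SET t = pt y -> x = y.
  by move=> ex ey; apply: (drawing_pt_inj D); rewrite -ex -ey.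
have := bdry _ _ _ cd tI; have := bdry _ _ _ ab sI.
move=> [es|[es|so]] [et|[et|to]].
all: try (have xy := V _ _ es et; move: U; rewrite xy /= !inE ?eqxx ?orbT //=;
  by rewrite ?andbF).
- by case: (inner _ _ _ _ cd to (etrans (esym e) es)).
- by case: (inner _ _ _ _ cd to (etrans (esym e) es)).
- by case: (inner _ _ _ _ ab so (etrans e et)).
- by case: (inner _ _ _ _ ab so (etrans e et)).
have ne : [set a; b]%SET != [set c; d]%SET.
  apply/eqP => /setP/(_ a); rewrite !inE eqxx /=; move: U.
  by rewrite /= !inE !negb_or -!andbA => /and5P[_ /negPf-> /negPf->].
have ix := drawing_no_crossing D (edge_set2 ab) (edge_set2 cd) ne.
suff : (set0 : set space) (arc [set a; b]%SET s) by [].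
by rewrite -ix; split; [exists s | exists t].
Qed.

Variables (A : pred G) (x y : space -> K).
Hypothesis xy_torus : forall P, W P -> torus_pt (x P, y P).
Hypotheses (x_cont : circ_continuous x) (y_cont : circ_continuous y).
Hypothesis xy_inj : forall P Q, W P -> W Q -> x P = x Q -> y P = y Q -> P = Q.
Hypothesis arcs_W : forall a b, adj a b -> A a -> A b ->
  arc [set a; b]%SET @` `[0, 1] `<=` W.

Let x01 P : W P -> 0 <= x P < 1. Proof. by move/xy_torus => /andP[]. Qed.
Let y01 P : W P -> 0 <= y P < 1. Proof. by move/xy_torus => /andP[]. Qed.

Let good (E : {set G}) : bool :=
  [exists a, exists b, [&& adj a b, A a, A b & E == [set a; b]%SET]].

Let goodP E : reflect (exists a b, [/\ adj a b, A a, A b & E = [set a; b]%SET])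
  (good E).
Proof.
apply: (iffP existsP) => -[a].
  by case/existsP=> b /and4P[? ? ? /eqP ?]; exists a, b.
by case=> b [? ? ? ?]; exists a; apply/existsP; exists b; apply/and4P; split=> //;
  exact/eqP.
Qed.

Let good_set2 a b : adj a b -> A a -> A b -> good [set a; b]%SET.
Proof. by move=> *; apply/goodP; exists a, b. Qed.

Let x_path E : good E -> circ_path (x \o arc E).
Proof.
case/goodP => a [b [ab Aa Ab ->]]; apply: circ_path_arc => //.
  exact: edge_set2.
exact: arcs_W.
Qed.

Let y_path E : good E -> circ_path (y \o arc E).
Proof.
case/goodP => a [b [ab Aa Ab ->]]; apply: circ_path_arc => //.
  exact: edge_set2.
exact: arcs_W.
Qed.

Let coord (P : space) : K * K := (x P, y P).

Let samples n E i : K * K := coord (arc E ((minn i n.+1)%:R / n.+1%:R)).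

Let clamp01 n i : 0 <= ((minn i n.+1)%:R / n.+1%:R : K) <= 1.
Proof. by rewrite divr_ge0 //= ler_pdivrMr // mul1r ler_nat geq_minr. Qed.

Let W_arc E s : good E -> 0 <= s <= 1 -> W (arc E s).
Proof.
case/goodP => a [b [ab Aa Ab ->]] sI; apply: (arcs_W ab Aa Ab).
by exists s => //=; rewrite in_itv.
Qed.

Let samples0 n E : samples n E 0 = coord (arc E 0).
Proof. by rewrite /samples min0n mul0r. Qed.

Let samplesN n E : samples n E n.+1 = coord (arc E 1).
Proof. by rewrite /samples minnn divff // pnatr_eq0. Qed.

(** The arcs are sampled so finely that steps are short compared with the distance
    between independent arcs; then [sympl_holonomy] applies to every pair of
    independent edges. Only the vertices of [A] are considered, because the
    coordinates may be available on a part [W] of the surface only. If coordinates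
    never differ by more than half a turn, no step wraps. *)
Lemma drawing_parity_data : exists h u o,
  parity_data [rel a b | [&& @adj G a b, A a & A b]] h u o /\
  ((forall P Q, W P -> W Q -> ~~ jump (x P) (x Q) /\ ~~ jump (y P) (y Q)) ->
   forall a b, h a b = (false, false)).
Proof.
have [k _ sepK] : \forall k \near \oo, forall q : G * G * G * G,
    uniq [:: q.1.1.1; q.1.1.2; q.1.2; q.2] ->
    adj q.1.1.1 q.1.1.2 -> A q.1.1.1 -> A q.1.1.2 ->
    adj q.1.2 q.2 -> A q.1.2 -> A q.2 ->
    forall s t : K, 0 <= s <= 1 -> 0 <= t <= 1 ->
    far_pts (k.+1%:R^-1 + k.+1%:R^-1)
      (coord (arc [set q.1.1.1; q.1.1.2]%SET s))
      (coord (arc [set q.1.2; q.2]%SET t)).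
  apply: filter_forall => -[[[a b] c] d] /=.
  have [[[U ab Aa Ab] [cd Ac Ad]]|no] :=
    pselect ([/\ uniq [:: a; b; c; d], adj a b, A a & A b] /\
             [/\ adj c d, A c & A d]); last first.
    by apply: nearW => n U ab Aa Ab cd Ac Ad; case: no.
  have g1 := good_set2 ab Aa Ab; have g2 := good_set2 cd Ac Ad.
  have := circ_path_far (x_path g1) (y_path g1) (x_path g2) (y_path g2).
  have dis s t : 0 <= s <= 1 -> 0 <= t <= 1 ->
    ~ ((x \o arc [set a; b]%SET) s = (x \o arc [set c; d]%SET) t /\
       (y \o arc [set a; b]%SET) s = (y \o arc [set c; d]%SET) t).
    move=> sI tI [ex ey]; apply: (arcs_disjoint U ab cd sI tI).
    by apply: xy_inj ex ey; apply: W_arc.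
  move/(_ dis); apply: filterS => n H _ _ _ _ _ _ _ s t; exact: H.
(* independent arcs are more than 2 t apart; the mesh makes every step at most t *)
pose t : K := k.+1%:R^-1; have t0 : 0 < t by rewrite invr_gt0.
have [n _ unif] : \forall n \near \oo, forall E, good E ->
    forall s s' : K, 0 <= s <= 1 -> 0 <= s' <= 1 -> `|s - s'| <= n.+1%:R^-1 ->
    near_pts t (coord (arc E s)) (coord (arc E s')).
  apply: filter_forall => E.
  have [g|/negP ng] := boolP (good E); last by apply: nearW => n g; case: ng.
  have := circ_path_uniform (y_path g) t0.
  apply: filterS2 (circ_path_uniform (x_path g) t0) => n Hx Hy _ s s' sI s'I ss'.
  by apply/andP; split; [exact: Hx | exact: Hy].
have {}sepK := sepK k (leqnn k); have {}unif := unif n (leqnn n).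
pose h a b : F22 := if good [set a; b]%SET
  then holonomy (samples n [set a; b]%SET) n.+1 else (false, false).
pose u v a b := sweeps (samples n [set a; b]%SET) n.+1 (coord (pt v)).
(* vertices outside A may share their coordinates with others *)
pose o a c := if coord (pt a) == coord (pt c) then (enum_rank a < enum_rank c)%N
  else right_of (coord (pt a)) (coord (pt c)).
exists h, u, o; split; last first.
  move=> nj a b; rewrite /h; case: ifP => // g; rewrite /holonomy.
  have j i : ~~ jump (samples n [set a; b]%SET i).1 (samples n [set a; b]%SET i.+1).1
     /\ ~~ jump (samples n [set a; b]%SET i).2 (samples n [set a; b]%SET i.+1).2.
    by apply: nj; apply: W_arc.
  by rewrite !big1 // => i _; apply/negbTE; case: (j i).
split=> [a c ac|].
  rewrite /o [coord (pt c) == _]eq_sym; case: eqVneq => [_|/right_ofN //].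
  by rewrite -leqNgt ltn_neqAle (inj_eq (@ord_inj _)) (inj_eq enum_rank_inj) ac.
move=> a b c d U /and3P[ab Aa Ab] /and3P[cd Ac Ad].
have g1 := good_set2 ab Aa Ab; have g2 := good_set2 cd Ac Ad.
have nearS E i : good E -> near_pts t (samples n E i) (samples n E i.+1).
  move=> g; apply: unif => //; rewrite -mulrBl normrM.
  rewrite [`|_^-1|]ger0_norm ?invr_ge0 // -[leRHS]mul1r ler_wpM2r ?invr_ge0 //.
  rewrite distrC -natrB; last by lia.
  by rewrite normr_nat (ler_nat _ _ 1); lia.
have TS E i : good E -> torus_pt (samples n E i).
  by move=> g; apply: xy_torus; apply: W_arc.
have farS i j : far_pts (t + t) (samples n [set a; b]%SET i) (samples n [set c; d]%SET j).
  by apply: (sepK (a, b, c, d)).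
have neS i j : samples n [set a; b]%SET i != samples n [set c; d]%SET j.
  apply/eqP => e; have := farS i j; rewrite e /far_pts /circ !subrr normr0 !lt_min.
  by move=> /orP[] /andP[]; lra.
rewrite /h g1 g2 (@sympl_holonomy _ t) //; do ?[by move=> *; apply: TS |
  by move=> *; apply: nearS | by move=> *; exact: farS].
rewrite !sweeps_byE //; do ?[by move=> *; exact: neS].
have endS p q : adj p q -> forall v, v \in [:: p; q] ->
    exists i, coord (pt v) = samples n [set p; q]%SET i.
  move=> pq v; case: (arc_endpoints pq) => -[e0 e1]; rewrite !inE => /orP[] /eqP->;
  by [exists 0%N; rewrite samples0 e0 | exists n.+1; rewrite samplesN e1].
have oE v w : v \in [:: a; b] -> w \in [:: c; d] ->
    o w v = right_of (coord (pt w)) (coord (pt v)).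
  move=> /(endS _ _ ab)[i ev] /(endS _ _ cd)[j ew].
  by rewrite /o ev ew eq_sym (negPf (neS i j)).
rewrite !oE ?inE ?eqxx ?orbT // /u !samples0 !samplesN.
move: (arc_endpoints ab) (arc_endpoints cd).
by move=> [] [-> ->] [] [-> ->]; parity.
Qed.

End DrawingParity.

(** * Coordinates on the surfaces *)

Section Continuity.
Variable K : realType.
Local Open Scope ring_scope.
Local Open Scope classical_set_scope.
Local Notation space := (K * K * K)%type.
Implicit Types (f g : space -> K) (P Q : space).

Definition cts f P : Prop := f Q @[Q --> P] --> f P.

Lemma cts_cst (a : K) P : cts (fun=> a) P.
Proof. exact: cvg_cst. Qed.

Lemma ctsD f g P : cts f P -> cts g P -> cts (fun Q => f Q + g Q) P.
Proof. by move=> cf cg; apply: cvgD. Qed.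

Lemma ctsB f g P : cts f P -> cts g P -> cts (fun Q => f Q - g Q) P.
Proof. by move=> cf cg; apply: cvgB. Qed.

Lemma ctsM f g P : cts f P -> cts g P -> cts (fun Q => f Q * g Q) P.
Proof. by move=> cf cg; apply: cvgM. Qed.

Lemma cts_norm f P : cts f P -> cts (fun Q => `|f Q|) P.
Proof. by move=> cf; apply: cvg_norm. Qed.

Lemma cts_max f g P : cts f P -> cts g P -> cts (fun Q => Num.max (f Q) (g Q)) P.
Proof. by move=> cf cg; apply: continuous_max. Qed.

Lemma cts_div f g P : cts f P -> cts g P -> g P != 0 -> cts (fun Q => f Q / g Q) P.
Proof. by move=> cf cg g0; apply: cvgM => //; apply: cvgV. Qed.

Lemma cts_sqrt f P : cts f P -> cts (fun Q => Num.sqrt (f Q)) P.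
Proof. by move=> cf; exact: (cvg_comp _ _ cf (@sqrt_continuous K (f P))). Qed.

Lemma cts1 P : cts (fun Q => Q.1.1) P.
Proof. by apply: (@cvg_comp _ _ _ fst fst); [exact: cvg_fst | exact: cvg_fst]. Qed.

Lemma cts2 P : cts (fun Q => Q.1.2) P.
Proof. by apply: (@cvg_comp _ _ _ fst snd); [exact: cvg_fst | exact: cvg_snd]. Qed.

Lemma cts3 P : cts (fun Q => Q.2) P.
Proof. exact: cvg_snd. Qed.

Lemma cts_near f P (e : K) : cts f P -> 0 < e -> \forall Q \near P, `|f P - f Q| < e.
Proof. by rewrite /cts => /cvgrPdist_lt cf e0; exact: cf. Qed.

Lemma cts_closed f (a b : K) : (forall P, cts f P) -> closed [set P | a <= f P <= b].
Proof.
move=> cf; have -> : [set P | a <= f P <= b] = f @^-1` `[a, b].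
  by apply/seteqP; split=> P /=; rewrite in_itv.
by apply: preimage_closed (@itv_closed _ K a b) => P _; exact: cf.
Qed.

Lemma cts_open f (a b : K) : (forall P, cts f P) -> open [set P | a < f P < b].
Proof.
move=> cf; have -> : [set P | a < f P < b] = f @^-1` `]a, b[.
  by apply/seteqP; split=> P /=; rewrite in_itv.
by apply: open_comp (@itv_open _ K a b) => P _; exact: cf.
Qed.

(** The frontier of the block lies between any closed set around the block and any
    open set inside it. *)
Lemma surface_sub n (C O : set space) : closed C -> open O ->
  drilled_block n `<=` C -> O `<=` drilled_block n ->
  surface n `<=` C `\` O.
Proof.
move=> cC oO BC OB P [PB PI]; split.
  by have := closure_subset BC PB; rewrite -(iffLR (closure_id _) cC).
by move=> OP; apply: PI; move: OB; rewrite (open_subsetE _ oO); apply.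
Qed.

(** A coordinate in [0, 1) of the direction of the vector (X, Y): the normalized
    arc length on the unit circle of the norm |X| + |Y|, starting at (1, 0). It is
    piecewise linear, unlike the angle. *)
Definition diamond (X Y : K) : K :=
  if 0 <= Y then (1 - X / (`|X| + `|Y|)) / 4 else (3 + X / (`|X| + `|Y|)) / 4.

(* the same coordinate on the unit circle itself *)
Let diamond1 (u v : K) : K := if 0 <= v then (1 - u) / 4 else (3 + u) / 4.

Lemma diamond_unit (X Y : K) : (X != 0) || (Y != 0) ->
  exists u v, [/\ `|u| + `|v| = 1, u = X / (`|X| + `|Y|), v = Y / (`|X| + `|Y|) &
    diamond X Y = diamond1 u v].
Proof.
move=> XY; have N0 : 0 < `|X| + `|Y|.
  by move: XY; rewrite -!normr_gt0; have := normr_ge0 X; have := normr_ge0 Y;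
    move=> ? ? /orP[] ?; lra.
exists (X / (`|X| + `|Y|)), (Y / (`|X| + `|Y|)); split=> //.
  rewrite !normrM normfV (ger0_norm (ltW N0)) -mulrDl divff //; exact: lt0r_neq0.
by rewrite /diamond /diamond1 pmulr_lge0 ?invr_gt0.
Qed.

Lemma diamond_range (X Y : K) : (X != 0) || (Y != 0) -> 0 <= diamond X Y < 1.
Proof.
move=> /diamond_unit[u [v [uv _ _ ->]]]; rewrite /diamond1; move: uv.
by case: ifP => [v0|/negbT v0]; case: (ger0P u); case: (ger0P v) => *; lra.
Qed.

Lemma diamond_inj (X Y X' Y' : K) :
  (X != 0) || (Y != 0) -> (X' != 0) || (Y' != 0) ->
  diamond X Y = diamond X' Y' ->
  X / (`|X| + `|Y|) = X' / (`|X'| + `|Y'|) /\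
  Y / (`|X| + `|Y|) = Y' / (`|X'| + `|Y'|).
Proof.
move=> /diamond_unit[u [v [uv <- <- ->]]] /diamond_unit[u' [v' [uv' <- <- ->]]].
have bnd (a b : K) : `|a| + `|b| = 1 -> -1 <= a /\ (b < 0 -> -1 < a).
  move=> ab; have aa := lerNnormlW (lexx `|a|); split; first by have := normr_ge0 b; lra.
  by move=> b0; have : 0 < `|b| by [rewrite normr_gt0 lt_eqF]; lra.
have [b1 b2] := bnd _ _ uv; have [b1' b2'] := bnd _ _ uv'.
rewrite /diamond1; case: ifP => [v0|/negbT]; case: ifP => [v0'|/negbT]; rewrite -?ltNge.
- move=> e; have uu : u = u' by lra.
  by split=> //; move: uv uv'; rewrite uu (ger0_norm v0) (ger0_norm v0'); lra.
- by move=> /b2' ? e; exfalso; lra.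
- by move=> /b2 ? e; exfalso; lra.
move=> v0' v0 e; have uu : u = u' by lra.
by split=> //; move: uv uv'; rewrite uu (ltr0_norm v0) (ltr0_norm v0'); lra.
Qed.

(** The coordinate does not jump at (1, 0), since 0 and 1 are the same point of the
    circle. *)
Lemma diamond1_lip (u v u' v' : K) : `|u| + `|v| = 1 -> `|u'| + `|v'| = 1 ->
  circ (diamond1 u v) (diamond1 u' v') <= `|u - u'| + `|v - v'|.
Proof.
have opp (a b a' b' : K) : `|a| + `|b| = 1 -> `|a'| + `|b'| = 1 ->
    0 <= b -> b' < 0 -> circ ((1 - a) / 4) ((3 + a') / 4) <= `|a - a'| + `|b - b'|.
  move=> ab ab' b0 b0'; rewrite leNgt; apply/negP; rewrite lt_min.
  have bb : `|b - b'| = b - b' by apply: ger0_norm; lra.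
  rewrite bb; rewrite (ger0_norm b0) in ab; rewrite (ltr0_norm b0') in ab'.
  have s0 : (1 - a) / 4 - (3 + a') / 4 <= 0.
    have := lerNnormlW (lexx `|a|); have := lerNnormlW (lexx `|a'|); lra.
  rewrite (ler0_norm s0) => /andP[]; move: ab ab'.
  by case: (ger0P a); case: (ger0P a'); case: (ger0P (a - a')) => *; lra.
move=> uv uv'; rewrite /diamond1.
have same (a b c d : K) : `|a - b| = `|c - d| / 4 ->
    circ a b <= `|c - d| + `|v - v'|.
  move=> ab; rewrite /circ ge_min ab; apply/orP; left.
  by have := normr_ge0 (c - d); have := normr_ge0 (v - v'); lra.
have quarter (a b : K) : a = b / 4 -> `|a| = `|b| / 4.
  by move=> ->; rewrite normrM [X in _ * X]ger0_norm // invr_ge0.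
case: ifP => [v0|/negbT]; case: ifP => [v0'|/negbT]; rewrite -?ltNge.
- by apply: same; rewrite -normrN; apply: quarter; lra.
- by move=> v0'; apply: opp.
- move=> v0; rewrite circC [`|u - u'|]distrC [`|v - v'|]distrC; exact: opp.
by move=> v0' v0; apply: same; apply: quarter; lra.
Qed.

Lemma diamond_cts f g P (e : K) : cts f P -> cts g P ->
  (f P != 0) || (g P != 0) -> 0 < e ->
  \forall Q \near P, circ (diamond (f P) (g P)) (diamond (f Q) (g Q)) < e.
Proof.
move=> cf cg fg0 e0; pose N Q := `|f Q| + `|g Q|.
have cN : cts N P by apply: ctsD; apply: cts_norm.
have N0 : 0 < N P.
  by move: fg0; rewrite -!normr_gt0 /N; have := normr_ge0 (f P);
    have := normr_ge0 (g P); move=> ? ? /orP[] ?; lra.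
have N1 := lt0r_neq0 N0.
have e2 : 0 < e / 2 by lra.
have H1 := cts_near (cts_div cf cN N1) e2.
have H2 := cts_near (cts_div cg cN N1) e2.
have H3 := cts_near cN N0.
near=> Q.
have NQ : 0 < N Q.
  have : `|N P - N Q| < N P by near: Q.
  by case: (ger0P (N P - N Q)) => *; lra.
have fgQ : (f Q != 0) || (g Q != 0).
  move: NQ; rewrite /N; apply: contraTT; rewrite negb_or !negbK.
  by move=> /andP[/eqP-> /eqP->]; rewrite normr0 addr0 ltxx.
have [u [v [uv eu ev ->]]] := diamond_unit fg0.
have [u' [v' [uv' eu' ev' ->]]] := diamond_unit fgQ.
apply: le_lt_trans (diamond1_lip uv uv') _; rewrite [e]splitr ltrD //.
  by rewrite eu eu'; near: Q.
by rewrite ev ev'; near: Q.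
Unshelve. all: by end_near. Qed.

End Continuity.

Section TorusCoordinates.
Variable K : realType.
Local Open Scope ring_scope.
Local Open Scope classical_set_scope.
Local Notation space := (K * K * K)%type.
Implicit Types P Q : space.

(* the square hole is a ball of radius 1/2 for the sup norm around (3/2, 3/2) *)
Let q1 P : K := P.1.1 - 3 / 2.
Let q2 P : K := P.1.2 - 3 / 2.
Let rad P : K := Num.max `|q1 P| `|q2 P|.

Let cts_q1 P : cts q1 P. Proof. by apply: ctsB; [exact: cts1 | exact: cts_cst]. Qed.
Let cts_q2 P : cts q2 P. Proof. by apply: ctsB; [exact: cts2 | exact: cts_cst]. Qed.
Let cts_rad P : cts rad P.
Proof. by apply: cts_max; apply: cts_norm. Qed.

Let drilled1P P : drilled_block 1 P <-> [/\ 0 <= P.1.1 <= 3, 0 <= P.1.2 <= 3,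
  0 <= P.2 <= 1 & ~~ ((1 < P.1.1 < 2) && (1 < P.1.2 < 2))].
Proof.
split=> [[x y z /(_ 0%N isT) h]|[x y z h]]; first by split.
by split=> // -[|//] _.
Qed.

Lemma surface1_sub : surface 1 `<=`
  ([set P | 1 / 2 <= rad P <= 3 / 2] `&` [set P | 0 <= P.2 <= 1]) `\`
  ([set P | 1 / 2 < rad P < 3 / 2] `&` [set P | 0 < P.2 < 1]).
Proof.
apply: surface_sub.
- apply: closedI; apply: cts_closed => // P; exact: cts3.
- apply: openI; apply: cts_open => // P; exact: cts3.
- move=> P /drilled1P[/andP[x0 x3] /andP[y0 y3] z1 /negP hole]; split=> //=.
  apply/andP; split; last by rewrite ge_max !ler_norml /q1 /q2; lra.
  rewrite leNgt; apply/negP; rewrite gt_max !ltr_norml /q1 /q2 => r; apply: hole.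
  by lra.
move=> P [] /= /andP[]; rewrite lt_max gt_max !ltr_norml => r1 r2 /andP[z0 z1].
apply/drilled1P; split; try by move: r2; rewrite /q1 /q2; lra.
apply/negP => hole; move: r1; apply/negP.
by rewrite negb_or -!leNgt !ler_norml /q1 /q2; lra.
Qed.

Definition torus_x P : K := diamond (q1 P) (q2 P).
Definition torus_y P : K := diamond (2 * rad P - 2) (2 * P.2 - 1).

Let q_neq0 P : surface 1 P -> (q1 P != 0) || (q2 P != 0).
Proof.
move=> /surface1_sub[[/= + _] _]; apply: contraTT; rewrite negb_or !negbK.
by rewrite /rad => /andP[/eqP-> /eqP->]; rewrite normr0 maxxx; lra.
Qed.

(* in the half-plane (radius, height), the tube is a square around its core *)
Let tube_sup P : surface 1 P ->
  Num.max `|2 * rad P - 2| `|2 * P.2 - 1| = 1.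
Proof.
move=> /surface1_sub[[/= r z] no].
have [r1 z1] : `|2 * rad P - 2| <= 1 /\ `|2 * P.2 - 1| <= 1.
  by rewrite !ler_norml; lra.
apply/le_anti; rewrite ge_max r1 z1 /= leNgt; apply/negP.
rewrite gt_max !ltr_norml => b; apply: no; split=> /=; lra.
Qed.

Let tube_neq0 P : surface 1 P -> (2 * rad P - 2 != 0) || (2 * P.2 - 1 != 0).
Proof.
move=> /tube_sup; case: eqP => //= ->; case: eqP => //= ->.
by rewrite normr0 maxxx => /esym/eqP; rewrite oner_eq0.
Qed.

Let max_scale (c a b a' b' : K) : 0 < c -> a' = c * a -> b' = c * b ->
  Num.max `|a'| `|b'| = c * Num.max `|a| `|b|.
Proof. by move=> c0 -> ->; rewrite !normrM (gtr0_norm c0) maxr_pMr // ltW. Qed.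

(* equal L1-normalizations mean positively proportional vectors *)
Let proportional (X Y X' Y' : K) :
  (X != 0) || (Y != 0) -> (X' != 0) || (Y' != 0) ->
  X / (`|X| + `|Y|) = X' / (`|X'| + `|Y'|) ->
  Y / (`|X| + `|Y|) = Y' / (`|X'| + `|Y'|) ->
  exists2 c, 0 < c & X' = c * X /\ Y' = c * Y.
Proof.
have N0 (A B : K) : (A != 0) || (B != 0) -> 0 < `|A| + `|B|.
  by rewrite -!normr_gt0; have := normr_ge0 A; have := normr_ge0 B;
    move=> ? ? /orP[] ?; lra.
move=> /N0 n0 /N0 n0' eX eY; exists ((`|X'| + `|Y'|) / (`|X| + `|Y|)).
  by rewrite divr_gt0.
have [m0 m0'] := (lt0r_neq0 n0, lt0r_neq0 n0').
split.
  by rewrite mulrAC -mulrA eX mulrC divfK.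
by rewrite mulrAC -mulrA eY mulrC divfK.
Qed.

(** The surface of genus 1 is the product of two circles: the direction of a point as
    seen from the axis of the hole, and its position on the rectangle cut out by the
    half-plane of that direction. *)
Lemma torus_coordinates (G : sgraph) : drawable (surface (K := K) 1) G ->
  exists h u o, parity_data (@adj G) h u o.
Proof.
case=> pt [arc D].
have [] := @drawing_parity_data K G (surface 1) (surface 1) pt arc D predT
  torus_x torus_y.
- move=> P SP; apply/andP; split; apply: diamond_range; [exact: q_neq0 | exact: tube_neq0].
- by move=> P SP e e0; apply: filterS (diamond_cts _ _ (q_neq0 SP) e0).
- move=> P SP e e0.
  have cr : cts (fun Q => 2 * rad Q - 2) P.
    apply: ctsB; last exact: cts_cst.
    by apply: ctsM; [exact: cts_cst | exact: cts_rad].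
  have cz : cts (fun Q => 2 * Q.2 - 1) P.
    apply: ctsB; last exact: cts_cst.
    by apply: ctsM; [exact: cts_cst | exact: cts3].
  by apply: filterS (diamond_cts cr cz (tube_neq0 SP) e0).
- move=> P Q SP SQ /(diamond_inj (q_neq0 SP) (q_neq0 SQ))[ex ey].
  move=> /(diamond_inj (tube_neq0 SP) (tube_neq0 SQ))[er ez].
  have [c c0 [cr cz]] := proportional (tube_neq0 SP) (tube_neq0 SQ) er ez.
  have c1 : c = 1.
    by have := max_scale c0 cr cz; rewrite !tube_sup // mulr1.
  move: cr cz; rewrite c1 !mul1r => cr cz.
  have rE : rad Q = rad P by lra.
  have zE : Q.2 = P.2 by lra.
  have [d d0 [dx dy]] := proportional (q_neq0 SP) (q_neq0 SQ) ex ey.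
  have rP : 0 < rad P by have [[/= ? _] _] := surface1_sub SP; lra.
  have d1 : d = 1.
    have := max_scale d0 dx dy; rewrite -/(rad P) -/(rad Q) rE => e.
    by apply: (mulIf (lt0r_neq0 rP)); rewrite mul1r -e.
  move: dx dy; rewrite d1 !mul1r /q1 /q2 => /addIr dx /addIr dy.
  by rewrite [P]surjective_pairing [P.1]surjective_pairing -dx -dy -zE -!surjective_pairing.
- move=> a b ab _ _; apply: (drawing_arc_in D); exact: edge_set2.
move=> h [u [r [H _]]]; exists h, u, r.
by case: H => oN H; split=> // a b c d U ab cd; apply: H; rewrite //= ?ab ?cd.
Qed.

End TorusCoordinates.

Section SphereCoordinates.
Variable K : realType.
Local Open Scope ring_scope.
Local Open Scope classical_set_scope.
Local Notation space := (K * K * K)%type.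
Implicit Types P Q : space.

Let q1 P : K := P.1.1 - 1 / 2.
Let q2 P : K := P.1.2 - 3 / 2.
Let q3 P : K := P.2 - 1 / 2.

Let cts_q1 P : cts q1 P. Proof. by apply: ctsB; [exact: cts1 | exact: cts_cst]. Qed.
Let cts_q2 P : cts q2 P. Proof. by apply: ctsB; [exact: cts2 | exact: cts_cst]. Qed.
Let cts_q3 P : cts q3 P. Proof. by apply: ctsB; [exact: cts3 | exact: cts_cst]. Qed.

(* the norm whose unit sphere is the frontier of the box *)
Let gauge (a b c : K) : K := Num.max (Num.max (2 * `|a|) (2 / 3 * `|b|)) (2 * `|c|).

Let gaugeZ (t a b c : K) : 0 < t -> gauge (t * a) (t * b) (t * c) = t * gauge a b c.
Proof.
move=> t0; rewrite /gauge !normrM (gtr0_norm t0) !maxr_pMr ?(ltW t0) //.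
by congr (Num.max (Num.max _ _) _); ring.
Qed.

Let gauge_surface P : surface 0 P -> gauge (q1 P) (q2 P) (q3 P) = 1.
Proof.
pose b Q := gauge (q1 Q) (q2 Q) (q3 Q).
have cb Q : cts b Q.
  by apply: cts_max; [apply: cts_max|]; apply: ctsM; do ?[exact: cts_cst];
    exact: cts_norm.
have sub : surface 0 `<=` [set Q | 0 <= b Q <= 1] `\` [set Q | -1 < b Q < 1].
  apply: surface_sub; [exact: cts_closed | exact: cts_open | |].
    move=> Q [/= x y z _]; rewrite /b /gauge !ge_max !le_max mulr_ge0 //=.
    have nb (a t : K) : 0 < t -> `|a| <= t^-1 -> t * `|a| <= 1.
      by move=> t0; rewrite -(ler_pM2l t0) divff // lt0r_neq0.
    have {}x : 0 <= Q.1.1 <= 1 := x.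
    have X : 2 * `|q1 Q| <= 1 by apply: nb => //; rewrite ler_norml /q1; lra.
    have Y : 2 / 3 * `|q2 Q| <= 1 by apply: nb; rewrite ?ler_norml /q2; lra.
    have Z : 2 * `|q3 Q| <= 1 by apply: nb => //; rewrite ler_norml /q3; lra.
    by rewrite X Y Z.
  move=> Q /= /andP[_]; rewrite /b /gauge !gt_max => /andP[/andP[x y] z].
  have nb (a t : K) : 0 < t -> t * `|a| < 1 -> - t^-1 < a < t^-1.
    move=> t0 h; have : `|a| < t^-1 by rewrite -(ltr_pM2l t0) divff ?lt0r_neq0.
    by rewrite ltr_norml.
  have X : - 2^-1 < q1 Q < 2^-1 by apply: nb x.
  have Y : - (2 / 3)^-1 < q2 Q < (2 / 3)^-1 by apply: nb y; lra.
  have Z : - 2^-1 < q3 Q < 2^-1 by apply: nb z.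
  move: X Y Z; rewrite /q1 /q2 /q3 => X Y Z.
  split=> //=.
  - by rewrite (_ : (0.*2.+1)%:R = 1 :> K) //; lra.
  - lra.
  lra.
move=> /sub[/= /andP[b0 b1] no]; apply/le_anti; rewrite b1 leNgt; apply/negP.
by move=> lt1; apply: no; rewrite /= lt1 (lt_le_trans _ b0) // ltrN10.
Qed.

Section Stereographic.
Variable P0 : space.
Hypothesis P0S : surface 0 P0.
Let n1 : K := q1 P0.
Let n2 : K := q2 P0.
Let n3 : K := q3 P0.
Let W : set space := surface 0 `\ P0.

(* stereographic projection, from the direction n of P0, of the direction q of P:
   the component of q orthogonal to n, divided by |n| |q| - n.q *)
Let nn : K := n1 ^+ 2 + n2 ^+ 2 + n3 ^+ 2.
Let qq P : K := q1 P ^+ 2 + q2 P ^+ 2 + q3 P ^+ 2.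
Let dot P : K := q1 P * n1 + q2 P * n2 + q3 P * n3.
Let den P : K := Num.sqrt nn * Num.sqrt (qq P) - dot P.
Let st1 P : K := (nn * q1 P - dot P * n1) / den P.
Let st2 P : K := (nn * q2 P - dot P * n2) / den P.
Let st3 P : K := (nn * q3 P - dot P * n3) / den P.

Let qq_gt0 P : surface 0 P -> 0 < qq P.
Proof.
move=> /gauge_surface g; rewrite lt0r.
have -> : 0 <= qq P by rewrite !addr_ge0 ?sqr_ge0.
rewrite andbT; apply/eqP => /eqP.
rewrite !paddr_eq0 ?addr_ge0 ?sqr_ge0 // !sqrf_eq0 => /andP[/andP[/eqP a /eqP b] /eqP c].
by move: g; rewrite a b c /gauge normr0 !mulr0 !maxxx => /eqP; rewrite eq_sym oner_eq0.
Qed.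

Let nn_gt0 : 0 < nn. Proof. exact: qq_gt0 P0S. Qed.

(* equality in Cauchy-Schwarz would put P on the ray from the centre through P0 *)
Let den_gt0 P : W P -> 0 < den P.
Proof.
move=> [SP /= ne]; rewrite subr_gt0 ltNge; apply/negP => le.
have r0 : 0 < Num.sqrt nn * Num.sqrt (qq P) by rewrite mulr_gt0 // sqrtr_gt0 // qq_gt0.
have d0 : 0 < dot P by exact: lt_le_trans le.
have sq : nn * qq P <= dot P ^+ 2.
  rewrite -[nn]sqr_sqrtr ?(ltW nn_gt0) // -[qq P]sqr_sqrtr ?(ltW (qq_gt0 SP)) //.
  by rewrite -exprMn lerXn2r // ?nnegrE ltW.
have lagrange : (q1 P * n2 - q2 P * n1) ^+ 2 + (q1 P * n3 - q3 P * n1) ^+ 2 +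
    (q2 P * n3 - q3 P * n2) ^+ 2 = nn * qq P - dot P ^+ 2.
  by rewrite /nn /qq /dot; ring.
have : (q1 P * n2 - q2 P * n1) ^+ 2 + (q1 P * n3 - q3 P * n1) ^+ 2 +
    (q2 P * n3 - q3 P * n2) ^+ 2 == 0.
  by rewrite eq_le lagrange subr_le0 sq /= -lagrange !addr_ge0 ?sqr_ge0.
rewrite !paddr_eq0 ?addr_ge0 ?sqr_ge0 // !sqrf_eq0 !subr_eq0.
move=> /andP[/andP[/eqP e12 /eqP e13] /eqP e23].
have nz := lt0r_neq0 nn_gt0.
have l0 : 0 < dot P / nn by rewrite divr_gt0.
have scale (a b : K) : nn * a = dot P * b -> a = dot P / nn * b.
  by move=> e; rewrite mulrAC -e mulrC mulKf.
have E1 : q1 P = dot P / nn * n1.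
  apply: scale; apply/eqP; rewrite -subr_eq0.
  have -> : nn * q1 P - dot P * n1 = n2 * (q1 P * n2 - q2 P * n1) + n3 * (q1 P * n3 - q3 P * n1).
    by rewrite /nn /dot; ring.
  by rewrite e12 e13 !subrr !mulr0 ?oppr0 addr0.
have E2 : q2 P = dot P / nn * n2.
  apply: scale; apply/eqP; rewrite -subr_eq0.
  have -> : nn * q2 P - dot P * n2 = - n1 * (q1 P * n2 - q2 P * n1) + n3 * (q2 P * n3 - q3 P * n2).
    by rewrite /nn /dot; ring.
  by rewrite e12 e23 !subrr !mulr0 ?oppr0 addr0.
have E3 : q3 P = dot P / nn * n3.
  apply: scale; apply/eqP; rewrite -subr_eq0.
  have -> : nn * q3 P - dot P * n3 = - n1 * (q1 P * n3 - q3 P * n1) - n2 * (q2 P * n3 - q3 P * n2).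
    by rewrite /nn /dot; ring.
  by rewrite e13 e23 !subrr !mulr0 ?oppr0 addr0.
have l1 : dot P / nn = 1.
  by have := gauge_surface SP; rewrite E1 E2 E3 gaugeZ // gauge_surface // mulr1.
apply: ne; move: E1 E2 E3; rewrite l1 !mul1r /n1 /n2 /n3 /q1 /q2 /q3.
move=> /addIr E1 /addIr E2 /addIr E3.
by rewrite [P]surjective_pairing [P.1]surjective_pairing E1 E2 E3 -!surjective_pairing.
Qed.

(* so the projection determines |q| / den, and the direction of P with it *)
Let st_sq P : W P -> st1 P ^+ 2 + st2 P ^+ 2 + st3 P ^+ 2 =
  nn * (2 * Num.sqrt nn * (Num.sqrt (qq P) / den P) - 1).
Proof.
move=> WP; have d0 := lt0r_neq0 (den_gt0 WP).
have num : (nn * q1 P - dot P * n1) ^+ 2 + (nn * q2 P - dot P * n2) ^+ 2 +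
    (nn * q3 P - dot P * n3) ^+ 2 = nn * (nn * qq P - dot P ^+ 2).
  by rewrite /nn /qq /dot; ring.
have fac : nn * qq P - dot P ^+ 2 =
    den P * (2 * Num.sqrt nn * Num.sqrt (qq P) - den P).
  rewrite -[nn in LHS]sqr_sqrtr ?(ltW nn_gt0) //.
  rewrite -[qq P in LHS]sqr_sqrtr ?(ltW (qq_gt0 (proj1 WP))) // /den; ring.
rewrite /st1 /st2 /st3 !expr_div_n -!mulrDl num fac; by field.
Qed.

Let st_inj P Q : W P -> W Q ->
  st1 P = st1 Q -> st2 P = st2 Q -> st3 P = st3 Q -> P = Q.
Proof.
move=> WP WQ e1 e2 e3.
have [dP dQ] := (den_gt0 WP, den_gt0 WQ).
have [dP0 dQ0] := (lt0r_neq0 dP, lt0r_neq0 dQ).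
have nn0 := lt0r_neq0 nn_gt0.
have rho0 : Num.sqrt nn != 0 by rewrite lt0r_neq0 // sqrtr_gt0.
have eR : Num.sqrt (qq P) / den P = Num.sqrt (qq Q) / den Q.
  have := st_sq WQ; rewrite -e1 -e2 -e3 (st_sq WP) => /(mulfI nn0)/addIr.
  by apply: mulfI; rewrite mulf_neq0 // pnatr_eq0.
have dotE R : W R -> dot R / den R = Num.sqrt nn * (Num.sqrt (qq R) / den R) - 1.
  move=> /den_gt0/lt0r_neq0 d0.
  have -> : dot R = Num.sqrt nn * Num.sqrt (qq R) - den R by rewrite /den; ring.
  by field.
have ed : dot P / den P = dot Q / den Q by rewrite !dotE // eR.
have back (a b c d : K) : (nn * a - dot P * d) / den P = (nn * b - dot Q * d) / den Q ->
    b = den Q / den P * a.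
  have split2 (x y z : K) : (nn * x - y * d) / z = nn * (x / z) - y / z * d by ring.
  by rewrite !split2 ed => /addIr/(mulfI nn0) e; rewrite mulrAC -mulrA e mulrC divfK.
have E1 : q1 Q = den Q / den P * q1 P by apply: back e1.
have E2 : q2 Q = den Q / den P * q2 P by apply: back e2.
have E3 : q3 Q = den Q / den P * q3 P by apply: back e3.
have l1 : den Q / den P = 1.
  have := gauge_surface (proj1 WQ).
  by rewrite E1 E2 E3 gaugeZ ?divr_gt0 // gauge_surface ?mulr1 //; case: WP.
move: E1 E2 E3; rewrite l1 !mul1r /q1 /q2 /q3 => /addIr E1 /addIr E2 /addIr E3.
by rewrite [P]surjective_pairing [P.1]surjective_pairing -E1 -E2 -E3
  -!surjective_pairing.
Qed.

Let st_orth P : W P -> n1 * st1 P + n2 * st2 P + n3 * st3 P = 0.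
Proof.
move=> /den_gt0/lt0r_neq0 d0; rewrite /st1 /st2 /st3 !mulrA -!mulrDl.
rewrite (_ : _ + _ + _ = 0) ?mul0r // /nn /dot; ring.
Qed.

Let cts_dot P : cts dot P.
Proof.
by do ?[apply: ctsD]; apply: ctsM => //; exact: cts_cst.
Qed.

Let cts_den P : cts den P.
Proof.
apply: ctsB => //; apply: ctsM; first exact: cts_cst.
apply: cts_sqrt; do ?[apply: ctsD]; exact: ctsM.
Qed.

Let cts_st (f : space -> K) (a : K) P : (forall Q, cts f Q) -> W P ->
  cts (fun Q => (nn * f Q - dot Q * a) / den Q) P.
Proof.
move=> cf /den_gt0/lt0r_neq0 d0; apply: cts_div => //.
by apply: ctsB; apply: ctsM => //; exact: cts_cst.
Qed.

(** The three components of the projection are linearly dependent, so that the one at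
    a nonzero coordinate of the centre may be dropped. *)
Lemma stereographic : exists f g : space -> K,
  [/\ forall P, W P -> cts f P, forall P, W P -> cts g P &
      forall P Q, W P -> W Q -> f P = f Q -> g P = g Q -> P = Q].
Proof.
have c1 P : W P -> cts st1 P by exact: cts_st.
have c2 P : W P -> cts st2 P by exact: cts_st.
have c3 P : W P -> cts st3 P by exact: cts_st.
have [z1|z1] := eqVneq n1 0; last first.
  exists st2, st3; split=> // P Q WP WQ e2 e3; apply: st_inj => //.
  apply: (mulfI z1); have := st_orth WQ; rewrite -(st_orth WP) e2 e3.
  by move/addIr/addIr.
have [z2|z2] := eqVneq n2 0; last first.
  exists st1, st3; split=> // P Q WP WQ e1 e3; apply: st_inj => //.
  apply: (mulfI z2); have := st_orth WQ; rewrite -(st_orth WP) e1 e3.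
  by move/addIr/addrI.
exists st1, st2; split=> // P Q WP WQ e1 e2; apply: st_inj => //.
have z3 : n3 != 0.
  by apply: contraTneq nn_gt0 => z3; rewrite /nn z1 z2 z3 expr0n /= !addr0 ltxx.
apply: (mulfI z3); have := st_orth WQ; rewrite -(st_orth WP) e1 e2.
by move/addrI.
Qed.

End Stereographic.

(* an injection of the line in ]1/4, 3/4[, an interval that never wraps *)
Let squash (s : K) : K := 1 / 2 + s / (4 * (1 + `|s|)).

Let squash_den (s : K) : 0 < 4 * (1 + `|s|).
Proof. by have := normr_ge0 s; lra. Qed.

Let squash_range s : 1 / 4 < squash s < 3 / 4.
Proof.
have d0 := squash_den s; have : `|s / (4 * (1 + `|s|))| < 1 / 4.
  rewrite normrM normfV (gtr0_norm d0) ltr_pdivrMr //; lra.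
by rewrite ltr_norml /squash; lra.
Qed.

Let squash_inj : injective squash.
Proof.
move=> s t /addrI /eqP; rewrite eqr_div ?lt0r_neq0 // => /eqP.
by case: (ger0P s); case: (ger0P t) => ? ? e; nra.
Qed.

Let cts_squash f P : cts f P -> cts (squash \o f) P.
Proof.
move=> cf; apply: ctsD; first exact: cts_cst.
apply: (@cts_div K f (fun Q => 4 * (1 + `|f Q|)) P cf).
  apply: ctsM; first exact: cts_cst.
  by apply: ctsD; [exact: cts_cst | exact: cts_norm].
exact: (lt0r_neq0 (squash_den (f P))).
Qed.

Let circ_cts f P (e : K) : cts f P -> 0 < e ->
  \forall Q \near P, circ (squash (f P)) (squash (f Q)) < e.
Proof.
move=> cf e0; apply: filterS (cts_near (cts_squash cf) e0) => Q.
by rewrite /circ gt_min => ->.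
Qed.

(** Without the arcs at one vertex [v], a drawing on the sphere lies in the sphere
    minus a point, which is a plane; a bounded plane wraps nowhere on the torus. *)
Lemma sphere_coordinates (G : sgraph) (v : G) : drawable (surface (K := K) 0) G ->
  exists h u o, parity_data [rel a b | [&& @adj G a b, a != v & b != v]] h u o /\
    forall a b, h a b = (false, false).
Proof.
case=> pt [arc D]; have P0S := drawing_pt_in D v.
have [f [g [cf cg fg]]] := stereographic P0S.
have sub : surface 0 `\ pt v `<=` surface 0 by move=> P [].
have [] := @drawing_parity_data K G (surface 0) (surface 0 `\ pt v) pt arc D
  (predC1 v) (squash \o f) (squash \o g).
- move=> P _; have := squash_range (f P); have := squash_range (g P).
  by rewrite /torus_pt /=; lra.
- by move=> P WP e e0; apply: filterS (circ_cts (cf _ WP) e0).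
- by move=> P WP e e0; apply: filterS (circ_cts (cg _ WP) e0).
- by move=> P Q WP WQ /squash_inj ? /squash_inj ?; exact: fg.
- move=> a b ab /= av bv P [s sI <-]; have E := edge_set2 ab; split.
    by apply: (drawing_arc_in D E); exists s.
  move=> /= ev; have no x : x != v -> arc [set a; b]%SET s <> pt x.
    by rewrite ev => /eqP + /(drawing_pt_inj D) => /[swap] ->.
  move: sI; rewrite /= in_itv /= => /andP[]; rewrite !le_eqVlt.
  case/orP=> [/eqP s0|s0].
    by case: (arc_endpoints D ab) => -[]; rewrite s0 => ? _; [case: (no a)|case: (no b)].
  case/orP=> [/eqP s1|s1].
    by case: (arc_endpoints D ab) => -[]; rewrite -s1 => _ ?; [case: (no b)|case: (no a)].
  apply: (drawing_arc_pt D E (v := v)); exists s => //=.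
  by rewrite in_itv /= s0 s1.
move=> h [u [r [H h0]]]; exists h, u, r; split=> //.
apply: h0 => P Q _ _; rewrite /jump -!leNgt !ler_norml /=.
have := squash_range (f P); have := squash_range (f Q).
have := squash_range (g P); have := squash_range (g Q); lra.
Qed.

End SphereCoordinates.

(** * Fans are planar *)

(** [hub] holds at one vertex at most, so that the graph without vertices is a fan as
    well; [pos] lays the other vertices on a line in such a way that edges between them
    join neighbours. *)
Definition is_fan (T : Type) (e : rel T) (hub : pred T) (pos : T -> nat) : Prop :=
  [/\ forall x y, hub x -> hub y -> x = y,
      forall x y, ~~ hub x -> ~~ hub y -> pos x = pos y -> x = y &
      forall x y, e x y -> ~~ hub x -> ~~ hub y ->
        pos x = (pos y).+1 \/ pos y = (pos x).+1].

Section FanDrawing.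
Variables (K : realType) (G : sgraph) (hub : pred G) (pos : G -> nat).
Hypothesis fanG : is_fan (@adj G) hub pos.
Local Open Scope ring_scope.
Local Open Scope classical_set_scope.
Local Notation space := (K * K * K)%type.

Lemma top_face (P : space) : 0 <= P.1.1 <= 1 -> 0 <= P.1.2 <= 3 -> P.2 = 1 ->
  surface 0 P.
Proof.
move=> x y z; split.
  by apply: subset_closure; split=> //; rewrite z lexx ler01.
rewrite /interior /= => /nbhs_ballP[r /= r0 sub].
have : drilled_block 0 (P.1, 1 + r / 2).
  apply: sub; split; first exact: ballxx.
  rewrite /= -ball_normE /= z opprD addNKr normrN gtr0_norm ?divr_gt0 //.
  by rewrite ltr_pdivrMr // ltr_pMr // ltr1n.
by case=> _ _ /= z1 _; lra.
Qed.

(* the vertices other than the hub stand on the segment from (0, 1) to (1, 1) of the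
   face z = 1, with distance 1/M between neighbours, and the hub at (1/2, 2) *)
Let M := (\max_(x : G) pos x).+1.

(* edges are oriented upwards for this level, in particular towards the hub *)
Let level x : nat := if hub x then M else pos x.

Let pos_lt x : (pos x < M)%N.
Proof. by rewrite /M ltnS; exact: (leq_bigmax x). Qed.

Let level_inj : injective level.
Proof.
case: fanG => hubI posI _ x y; rewrite /level.
case: ifPn => hx; case: ifPn => hy; [by move=> _; exact: hubI | | |exact: posI].
  by move=> e; have := pos_lt y; rewrite -e ltnn.
by move=> e; have := pos_lt x; rewrite e ltnn.
Qed.

Let X x : K := (pos x)%:R / M%:R.

Let M0 : 0 < M%:R :> K. Proof. by rewrite ltr0n. Qed.

Let X01 x : 0 <= X x <= 1.
Proof. by rewrite divr_ge0 //= ler_pdivrMr // mul1r ler_nat ltnW. Qed.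

Let pt x : space := if hub x then (1 / 2, 2, 1) else (X x, 1, 1).

Let line (P Q : space) (t : K) : space :=
  ((1 - t) * P.1.1 + t * Q.1.1, (1 - t) * P.1.2 + t * Q.1.2, 1).

Let arc (E : {set G}) : K -> space :=
  if [pick ab : G * G | [&& E == [set ab.1; ab.2]%SET, adj ab.1 ab.2 &
      (level ab.1 < level ab.2)%N]] is Some ab then line (pt ab.1) (pt ab.2) else fun=> (0, 0, 1).

Let arc_line E : E \in edges G -> exists a b,
  [/\ E = [set a; b]%SET, adj a b, (level a < level b)%N & arc E = line (pt a) (pt b)].
Proof.
rewrite inE => /existsP[c /existsP[d /andP[cd /eqP ecd]]]; rewrite /arc.
case: pickP => [[a b] /= /and3P[/eqP eab ab lt]|no]; first by exists a, b.
have := ltngtP (level c) (level d); case=> [lt|lt|/level_inj e].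
- by have := no (c, d); rewrite /= ecd eqxx cd lt.
- by have := no (d, c); rewrite /= ecd finset.setUC eqxx adj_sym cd lt.
by move: cd; rewrite e adj_irr.
Qed.

Let arcP E : E \in edges G -> exists a b,
  [/\ E = [set a; b]%SET, arc E = line (pt a) (pt b), ~~ hub a &
    (hub b /\ forall t, arc E t = (X a + t * (1 / 2 - X a), 1 + t, 1)) \/
    [/\ ~~ hub b, pos b = (pos a).+1 & forall t, arc E t = (X a + t * M%:R^-1, 1, 1)]].
Proof.
case: fanG => _ _ adj_pos.
move=> /arc_line[a [b [eab ab lt ->]]]; exists a, b.
have hub_a : ~~ hub a.
  apply: contraTN lt => ha; rewrite /level ha -leqNgt; case: ifP => // _.
  exact: ltnW (pos_lt b).
split=> //; rewrite /line /pt (negPf hub_a); case: ifPn => hub_b; [left|right].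
  by split=> // t /=; congr (_, _, _); ring.
have pos_b : pos b = (pos a).+1.
  move: lt; rewrite /level (negPf hub_a) (negPf hub_b).
  by case: (adj_pos _ _ ab hub_a hub_b) => // ->; rewrite ltnNge leqnSn.
split=> // t /=; congr (_, _, _); last by ring.
by rewrite /X pos_b -natr1; field; rewrite pnatr_eq0.
Qed.

Let XI a b : X a = X b -> pos a = pos b.
Proof.
by move=> /(mulIf (invr_neq0 (lt0r_neq0 M0)))/eqP; rewrite eqr_nat => /eqP.
Qed.

Let pt_eq a s t : ((s, t, 1) : space) = pt a ->
  (hub a /\ s = 1 / 2 /\ t = 2) \/ (~~ hub a /\ s = X a /\ t = 1).
Proof.
by rewrite /pt; case: ifPn => h [-> ->]; [left | right].
Qed.

Let ptI : injective pt.
Proof.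
case: fanG => hubI posI _ x y; rewrite {1}/pt; case: ifPn => hx /pt_eq[[hy [e1 e2]]|[hy [e1 e2]]].
- exact: hubI.
- by exfalso; lra.
- by exfalso; lra.
by apply: posI => //; exact: XI.
Qed.

Lemma fan_drawable : drawable (surface (K := K) 0) G.
Proof.
exists pt, arc.
have Mi : 0 < M%:R^-1 :> K by rewrite invr_gt0.
have step a b (s t : K) : 0 < s < 1 -> 0 <= t < 1 ->
    X a + s * M%:R^-1 = X b + t * M%:R^-1 -> pos a = pos b.
  move=> s1 t1; rewrite /X -!mulrDl => /(mulIf (lt0r_neq0 Mi)) e.
  apply/eqP; rewrite eqn_leq; apply/andP; split; rewrite leqNgt; apply/negP;
  by rewrite -(ler_nat K) -natr1 => lt; lra.
have posI a b : ~~ hub a -> ~~ hub b -> pos a = pos b -> a = b.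
  by case: fanG => _ + _; apply.
have hubI a b : hub a -> hub b -> a = b by case: fanG => + _ _; apply.
have XM a b : ~~ hub a -> ~~ hub b -> pos b = (pos a).+1 -> X a + M%:R^-1 <= 1.
  move=> ha hb pb; have /andP[_] := X01 b.
  by rewrite /X pb -natr1 mulrDl mul1r.
have pt_face x : surface 0 (pt x).
  rewrite /pt; case: ifP => _; apply: top_face => //=; try lra; exact: X01.
have ends E a b : E = [set a; b]%SET -> arc E = line (pt a) (pt b) ->
    arc E 0 = pt a /\ arc E 1 = pt b.
  move=> _ ->; rewrite /line /pt; case: ifP => _; case: ifP => _ /=;
  by split; congr (_, _, _); ring.
split.
- exact: ptI.
- exact: pt_face.
- move=> E /arcP[a [b [_ -> _ _]]]; apply: continuous_subspaceT => t.
  have lin (x y : K) : (1 - u) * x + u * y @[u --> t] --> (1 - t) * x + t * y.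
    apply: cvgD; apply: cvgM; try exact: cvg_cst; try exact: cvg_id.
    by apply: cvgB; [exact: cvg_cst | exact: cvg_id].
  exact: (cvg_pair (cvg_pair (lin _ _) (lin _ _)) (cvg_cst (1 : K))).
- move=> E /arcP[a [b [_ _ _]]] [[_ f]|[_ _ f]] s t _ _; rewrite !f; case.
    by move=> _ /addrI.
  by move=> /addrI/(mulIf (lt0r_neq0 Mi)).
- move=> E /arcP[a [b [_ _ ha]]] fE P [t /=]; rewrite in_itv /= => tI <-.
  have xa := X01 a; case: fE => [[hb f]|[hb pb f]]; rewrite f; apply: top_face => //=.
  + by nra.
  + lra.
  + have := XM _ _ ha hb pb; nra.
  + lra.
- move=> E /arcP[a [b [eab el _ _]]]; have [-> ->] := ends _ _ _ eab el.
  apply/seteqP; split=> P /=.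
    by case=> ->; [exists a | exists b] => //; rewrite eab /= !inE eqxx ?orbT.
  by case=> v; rewrite eab /= !inE => /orP[] /eqP-> <-; [left | right].
- move=> E v /arcP[a [b [_ _ ha]]] fE [t /=]; rewrite in_itv /= => tI.
  case: fE => [[hb f]|[hb pb f]]; rewrite f => /pt_eq[[hv [e1 e2]]|[hv [e1 e2]]].
  + lra.
  + lra.
  + lra.
  have t0 : 0 <= (0 : K) < 1 by lra.
  have e : pos a = pos v by apply: (step a v t 0) => //; rewrite mul0r addr0.
  by move: e1; rewrite /X e; nra.
move=> E F /arcP[a [b [eab _ ha fE]]] /arcP[c [d [ecd _ hc fF]]] ne.
apply/seteqP; split=> // P [[s /=]]; rewrite in_itv /= => sI <- [t].
rewrite /= in_itv /= => tI.
have {}ne : [set a; b]%SET <> [set c; d]%SET by rewrite -eab -ecd; exact/eqP.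
have t1 : 0 <= t < 1 by lra.
case: fE fF => [[hb ->]|[hb pb ->]] [[hd ->]|[hd pd ->]] e;
  have /= e1 := congr1 (fun P : space => P.1.1) e;
  have /= e2 := congr1 (fun P : space => P.1.2) e; clear e.
- have st : t = s by lra.
  apply: ne; rewrite (hubI b d) //; congr [set _; _]%SET; apply: posI => //.
  have : (1 - s) * (X c - X a) = 0.
    by rewrite -[RHS](subrr (X a + s * (1 / 2 - X a))) -{1}e1 st; ring.
  move=> /eqP; rewrite mulf_eq0 => /orP[/eqP|]; first by move=> ?; exfalso; lra.
  by rewrite subr_eq0 => /eqP/XI/esym.
- by exfalso; lra.
- by exfalso; lra.
apply: ne; have ac : pos a = pos c by apply: step (esym e1).
by rewrite (posI a c ha hc ac) (posI b d hb hd) // pb pd ac.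
Qed.

End FanDrawing.

Lemma fan_no_K4 (G : sgraph) (hub : pred G) (pos : G -> nat) :
  is_fan (@adj G) hub pos -> has_complete_subgraph G 4 -> False.
Proof.
move=> fanG.
case/existsP=> f /andP[/injectiveP fI /forallP C].
case: fanG => hubI posI adj_pos.
have A i j : i != j -> adj (f i) (f j) by move=> ij; have /forallP/(_ j)/implyP := C i; apply.
have two i j k : uniq [:: i; j; k] -> hub (f i) || hub (f j) || hub (f k).
  rewrite /= !inE negb_or => /and3P[/andP[ij ik] jk _]; apply: contraT.
  rewrite !negb_or => /andP[/andP[hi hj] hk].
  have := adj_pos _ _ (A _ _ ij) hi hj; have := adj_pos _ _ (A _ _ ik) hi hk.
  by have := adj_pos _ _ (A _ _ jk) hj hk; lia.
have one i j : i != j -> hub (f i) -> hub (f j) -> False.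
  by move=> ij hi hj; move/eqP: ij; apply; apply: fI; apply: hubI.
pose i0 : 'I_4 := inord 0; pose i1 : 'I_4 := inord 1.
pose i2 : 'I_4 := inord 2; pose i3 : 'I_4 := inord 3.
have n x y : (x < 4)%N -> (y < 4)%N -> ((inord x : 'I_4) == inord y) = (x == y).
  by move=> ? ?; rewrite -val_eqE /= !inordK.
have t012 := two i0 i1 i2; have t013 := two i0 i1 i3.
have t023 := two i0 i2 i3; have t123 := two i1 i2 i3.
have o01 := one i0 i1; have o02 := one i0 i2; have o03 := one i0 i3.
have o12 := one i1 i2; have o13 := one i1 i3; have o23 := one i2 i3.
rewrite /= !inE !n //= in t012 t013 t023 t123 o01 o02 o03 o12 o13 o23.
case h0 : (hub (f i0)) t012 t013 t023 t123 o01 o02 o03 o12 o13 o23;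
case h1 : (hub (f i1)); case h2 : (hub (f i2)); case h3 : (hub (f i3)); rewrite /=;
  move=> A1 A2 A3 A4 B1 B2 B3 B4 B5 B6;
  by [case: B1 | case: B2 | case: B3 | case: B4 | case: B5 | case: B6 |
      move: (A1 isT) | move: (A2 isT) | move: (A3 isT) | move: (A4 isT)].
Qed.

(** * Zero-divisor graphs without K_{2,3} *)

(** A vertex s is a pair (b s, eps s) and edges join vertices whose components b are
    partners, except when both have eps = 1. The partners u, v then carry the path
    (v, 1) - (u, 0) - (v, 0) - (u, 1), where u is the first of the two; if u is its
    own partner, the path is (u, 0) - (u, 1). Each pair of partners receives four
    consecutive positions. *)
Section PathPositions.
Variables (T U : finType) (b : T -> U) (eps : T -> bool) (p : rel U).
Hypotheses (pC : symmetric p) (pU : forall u v w, p u v -> p u w -> v = w).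

Let partner u := if [pick v | p u v] is Some v then v else u.

Let partnerE u v : p u v -> partner u = v.
Proof.
by rewrite /partner; case: pickP => [w pw pv|/(_ v)->//]; exact: pU pw pv.
Qed.

Let partnerK : involutive partner.
Proof.
move=> u; rewrite {2}/partner; case: pickP => [w pw|no].
  by rewrite (partnerE (_ : p w u)) // pC.
by rewrite /partner; case: pickP => // w; rewrite no.
Qed.

Let first u := if (enum_rank (partner u) < enum_rank u)%N then partner u else u.

Let offset u (e : bool) : nat :=
  if partner u == u then if e then 2 else 1
  else if first u == u then if e then 3 else 1
  else if e then 0 else 2.

Lemma path_positions : exists pos : T -> nat,
  (forall s t, pos s = pos t -> b s = b t /\ eps s = eps t) /\
  (forall s t, p (b s) (b t) -> ~~ (eps s && eps t) ->
     (b s != b t) || (eps s != eps t) ->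
     pos s = (pos t).+1 \/ pos t = (pos s).+1).
Proof.
exists (fun s => 4 * enum_rank (first (b s)) + offset (b s) (eps s))%N.
have off_lt u e : (offset u e < 4)%N.
  by rewrite /offset; do ![case: ifP => _].
have firstP u : first u = u \/ first u = partner u.
  by rewrite /first; case: ifP; [right | left].
have first_partner u : first (partner u) = first u.
  rewrite /first partnerK; case: ltngtP => // /(@ord_inj _)/enum_rank_inj.
  by move=> e; rewrite -e.
split=> s t.
  move=> E; have [eF eO] : first (b s) = first (b t) /\
      offset (b s) (eps s) = offset (b t) (eps t).
    have := off_lt (b s) (eps s); have := off_lt (b t) (eps t).
    move: E; set x := offset _ _; set y := offset _ _ => E y4 x4.
    have r : enum_rank (first (b s)) = enum_rank (first (b t)) :> nat by lia.
    split; first by apply: enum_rank_inj; apply: ord_inj.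
    by lia.
  have [e|ne] := eqVneq (b t) (b s).
    split=> //; move: eO; rewrite /offset e.
    by do ![case: ifP => _]; case: (eps s); case: (eps t).
  have tE : b t = partner (b s).
    have := firstP (b t); rewrite -eF; have := firstP (b s).
    move=> [->|->] [] // e; first by rewrite e eqxx in ne.
      by rewrite [in RHS]e partnerK.
    by move: ne; rewrite -[b t]partnerK -e partnerK eqxx.
  move: eO; rewrite tE /offset first_partner partnerK.
  have ns : partner (b s) != b s by rewrite -tE.
  have ns' : b s != partner (b s) by rewrite eq_sym.
  rewrite (negPf ns) (negPf ns').
  have := firstP (b s) => -[->|->]; rewrite ?eqxx ?(negPf ns) ?(negPf ns').
    by case: (eps s); case: (eps t).
  by case: (eps s); case: (eps t).
move=> pst e2; have bt : b t = partner (b s) by rewrite (partnerE pst).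
rewrite bt /offset first_partner partnerK.
have [e|ns] := eqVneq (partner (b s)) (b s).
  by rewrite /=; move: e2; case: (eps s); case: (eps t) => //= _ _; lia.
have ns' : b s != partner (b s) by rewrite eq_sym.
rewrite /=; have [->|->] := firstP (b s);
  rewrite ?eqxx ?(negPf ns) ?(negPf ns');
  by move: e2; case: (eps s); case: (eps t) => //= _ _; lia.
Qed.

End PathPositions.

Section Trichotomy.
Variable S : finComNzRingType.
Local Open Scope ring_scope.
Implicit Types (x y z c e : S).

Definition ring_K23 : Prop := exists x1 x2 y1 y2 y3 : S,
  uniq [:: 0; x1; x2; y1; y2; y3] /\
  {in [:: x1; x2] & [:: y1; y2; y3], forall x y, x * y = 0}.

Definition ring_null4 : Prop := exists a b c d : S,
  uniq [:: 0; a; b; c; d] /\ {in [:: a; b; c; d] &, forall x y, x * y = 0}.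

Definition ring_fan : Prop := exists (hub : pred S) (pos : S -> nat),
  [/\ forall x y, hub x -> hub y -> x = y,
      forall x y, nonzero_zero_divisor x -> nonzero_zero_divisor y ->
        ~~ hub x -> ~~ hub y -> pos x = pos y -> x = y &
      forall x y, nonzero_zero_divisor x -> nonzero_zero_divisor y ->
        x != y -> x * y = 0 -> ~~ hub x -> ~~ hub y ->
        pos x = (pos y).+1 \/ pos y = (pos x).+1].

Lemma K23I x1 x2 y1 y2 y3 :
  [/\ x1 != 0, x2 != 0 & x1 != x2] ->
  [/\ y1 != 0, y2 != 0 & y3 != 0] -> [/\ y1 != y2, y1 != y3 & y2 != y3] ->
  [/\ x1 != y1, x1 != y2 & x1 != y3] -> [/\ x2 != y1, x2 != y2 & x2 != y3] ->
  [/\ x1 * y1 = 0, x1 * y2 = 0 & x1 * y3 = 0] ->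
  [/\ x2 * y1 = 0, x2 * y2 = 0 & x2 * y3 = 0] -> ring_K23.
Proof.
move=> [x10 x20 xx] [y10 y20 y30] [y12 y13 y23] [d1 d2 d3] [d4 d5 d6] [e1 e2 e3] [e4 e5 e6].
exists x1, x2, y1, y2, y3; split.
  rewrite /= !inE !negb_or ![0 == _]eq_sym.
  by rewrite x10 x20 y10 y20 y30 xx d1 d2 d3 d4 d5 d6 y12 y13 y23.
by move=> x y; rewrite !inE => /orP[] /eqP-> /or3P[] /eqP->.
Qed.

Lemma zero_divisorI x y : x != 0 -> y != 0 -> x * y = 0 -> nonzero_zero_divisor x.
Proof.
by move=> x0 y0 xy; rewrite /nonzero_zero_divisor x0; apply/existsP; exists y;
  rewrite y0 xy eqxx.
Qed.

Lemma zero_divisorP x : nonzero_zero_divisor x ->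
  x != 0 /\ exists2 y, y != 0 & x * y = 0.
Proof.
by case/andP=> x0 /existsP[y /andP[y0 /eqP xy]]; split=> //; exists y.
Qed.

(** The powers of [x] are eventually periodic; a multiple of the period serves as
    exponent. *)
Lemma power_idempotent x : exists2 n, (0 < n)%N & x ^+ (n + n) = x ^+ n.
Proof.
pose f (i : 'I_#|S|.+1) := x ^+ i.
have /injectivePn[i [j ij e]] : ~~ injectiveb f.
  apply/negP => /injectiveP/leq_card; rewrite card_ord.
  by rewrite ltnn.
wlog lt : i j ij e / (i < j)%N.
  move=> H; case: (ltngtP i j) => [|/H|/(@ord_inj _)/eqP]; first exact: H.
    by apply; rewrite 1?eq_sym.
  by rewrite (negPf ij).
have e1 n : (i <= n)%N -> x ^+ (n + (j - i)) = x ^+ n.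
  move=> le; have -> : (n + (j - i) = (n - i) + j)%N by lia.
  by rewrite exprD -[x ^+ j]e -exprD subnK.
have e2 n k : (i <= n)%N -> x ^+ (n + k * (j - i)) = x ^+ n.
  move=> le; elim: k => [|k IHk]; first by rewrite mul0n addn0.
  by rewrite mulSn addnCA addnC e1 ?IHk //; lia.
exists (i.+1 * (j - i))%N; first by rewrite muln_gt0 subn_gt0.
by rewrite e2 // (leq_trans (leqnSn i)) // leq_pmulr // subn_gt0.
Qed.

Hypothesis noK23 : ~ ring_K23.

Section Local.
Hypothesis noidem : forall e, e * e = e -> e = 0 \/ e = 1.

Let zd x := (x == 0) || nonzero_zero_divisor x.

Let zd_nilp x : zd x -> exists n, x ^+ n = 0.
Proof.
case/orP=> [/eqP->|/zero_divisorP[_ [y y0 xy]]]; first by exists 1%N; rewrite expr1.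
have [n n0 e] := power_idempotent x; exists n.
case: (@noidem (x ^+ n)) => // [|x1]; first by rewrite -exprD.
by move: y0; rewrite -[y]mul1r -x1 -(prednK n0) exprSr -mulrA xy mulr0 eqxx.
Qed.

Let soc x := forall y, zd y -> x * y = 0.

(* c is chosen with an annihilator of maximal size; if c y <> 0, then c y and c have
   the same annihilator, so that no c y ^ k vanishes, although y is nilpotent *)
Let soc_exists x : nonzero_zero_divisor x -> exists c, [/\ c != 0, zd c & soc c].
Proof.
move=> x0; pose ann z : {set S} := [set w | z * w == 0].
have [c zc max] := @arg_maxnP S x (@nonzero_zero_divisor S) (fun z => #|ann z|) x0.
have [c0 [w w0 cw]] := zero_divisorP zc.
exists c; split=> //; first by rewrite /zd zc orbT.
move=> y /zd_nilp[n yn]; apply/eqP; apply: contraT => cy.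
have zcy : nonzero_zero_divisor (c * y).
  by apply: (zero_divisorI cy w0); rewrite mulrAC cw mul0r.
have sub : ann c \subset ann (c * y).
  by apply/fintype.subsetP => z; rewrite !inE mulrAC => /eqP->; rewrite mul0r.
have /eqP E : ann c == ann (c * y) by rewrite eqEcard sub; exact: max.
have nz k : c * y ^+ k != 0.
  elim: k => [|k IHk]; first by rewrite expr0 mulr1.
  apply: contra IHk; rewrite exprS mulrA => h.
  by have : y ^+ k \in ann c; [rewrite E inE | rewrite inE].
by move: (nz n); rewrite yn mulr0 eqxx.
Qed.

(** The element [c] annihilates all zero divisors. If it is the only one, a vertex x
    with two neighbours y, z other than c gives a K_{2,3}: c and x have at most two
    common neighbours, so z = y + c, and then c, y, z are common neighbours of x and
    x + c. So c is the hub and the rest is a matching. If c' is another one, a zero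
    divisor a that is not annihilated by all others would give three common
    neighbours a, a + c, a + c' of c and c'; hence all products vanish, and the
    existence of x, y, z provides the four elements of [ring_null4]. *)
Lemma local_trichotomy : ring_null4 \/ ring_fan.
Proof.
have [v0 zv0|none] := pickP (@nonzero_zero_divisor S); last first.
  by right; exists pred0, (fun=> 0%N); split=> // x y; rewrite none.
have [c [c0 zc sc]] := soc_exists zv0.
have kill y : nonzero_zero_divisor y -> c * y = 0.
  by move=> zy; apply: sc; rewrite /zd zy orbT.
have [[x [y [z [[zx zy zz] [xc yc zneqc] [xy xz yz] [exy exz]]]]]|no] := pselect
  (exists x y z, [/\ [/\ nonzero_zero_divisor x, nonzero_zero_divisor y &
      nonzero_zero_divisor z], [/\ x != c, y != c & z != c],
    [/\ x != y, x != z & y != z] & x * y = 0 /\ x * z = 0]); last first.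
  right; pose p x y := [&& x != y, x != c, y != c, nonzero_zero_divisor x,
    nonzero_zero_divisor y & x * y == 0].
  have pC : symmetric p.
    by move=> x y; rewrite /p eq_sym mulrC; do !bool_congr.
  have pU u v w : p u v -> p u w -> v = w.
    move=> /and5P[uv uc vc zu /andP[zv /eqP e1]].
    move=> /and5P[uw _ wc _ /andP[zw /eqP e2]].
    by apply/eqP; apply: contraT => vw; case: no; exists u, v, w.
  have [pos [posI posp]] := path_positions id pred0 pC pU.
  exists (pred1 c), pos; split=> [x y /eqP-> /eqP->//|x y _ _ _ _ /posI[]//|].
  move=> x y zx zy xy e xc yc; apply: posp => //=; last by rewrite xy.
  by apply/and5P; split=> //; apply/andP; split=> //; exact/eqP.
left; have [x0 _] := zero_divisorP zx; have [y0 _] := zero_divisorP zy.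
have [z0 _] := zero_divisorP zz.
have [cx cy cz] := And3 (kill _ zx) (kill _ zy) (kill _ zz).
have cc : c * c = 0 by apply: sc.
have soc_neq0 a : soc a -> a != 0 -> nonzero_zero_divisor a.
  by move=> sa a0; apply: (zero_divisorI a0 c0); apply: sa.
have [[c' [sc' c'0 c'c]]|uniq_c] :=
  pselect (exists c', [/\ soc c', c' != 0 & c' != c]).
  have all_soc (a : S) : nonzero_zero_divisor a -> soc a.
    move=> za; apply: contrapT => na; case: noK23.
    have [a0 _] := zero_divisorP za.
    have zc' : zd c' by rewrite /zd soc_neq0 ?orbT.
    have out b : soc b -> [/\ a + b != 0, a + b != c & a + b != c'].
      move=> sb; have socB d : soc d -> a + b <> d.
        move=> sd e; apply: na => w zw; have -> : a = d - b by rewrite -e addrK.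
        by rewrite mulrBl sd ?sb ?subrr.
      by split; apply/eqP; apply: socB => // w _; rewrite mul0r.
    have [m1 m2 m3] := out 0 (fun y _ => mul0r y); rewrite addr0 in m1 m2 m3.
    have [p1 p2 p3] := out c sc; have [r1 r2 r3] := out c' sc'.
    have k d : soc d -> d * a = 0 by apply; rewrite /zd za orbT.
    apply: (@K23I c c' a (a + c) (a + c')); split=> //; rewrite 1?eq_sym //.
    - by rewrite -subr_eq0 addrAC subrr add0r.
    - by rewrite -subr_eq0 addrAC subrr add0r.
    - by rewrite eq_sym (inj_eq (addrI _)) eq_sym.
    - exact: k.
    - by rewrite mulrDr (k c sc) add0r cc.
    - by rewrite mulrDr (k c sc) add0r; apply: sc.
    - exact: k.
    - by rewrite mulrDr (k c' sc') add0r; apply: sc'.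
    - by rewrite mulrDr (k c' sc') add0r; apply: sc'.
  have null (a b : S) : nonzero_zero_divisor a -> nonzero_zero_divisor b -> a * b = 0.
    by move=> za zb; apply: (all_soc _ za b); rewrite /zd zb orbT.
  have zc1 : nonzero_zero_divisor c by exact: soc_neq0.
  have zc1' : nonzero_zero_divisor c' by exact: soc_neq0.
  have N4 (a b : S) : nonzero_zero_divisor a -> nonzero_zero_divisor b ->
      a != c -> b != c -> a != c' -> b != c' -> a != b -> ring_null4.
    move=> za zb ac bc ac' bc' ab; have [a0 _] := zero_divisorP za.
    have [b0 _] := zero_divisorP zb; exists c, c', a, b; split.
      by rewrite /= !inE !negb_or; do ?(apply/andP; split); rewrite // eq_sym.
    by move=> u v; rewrite !inE => /or4P[] /eqP-> /or4P[] /eqP->; apply: null.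
  have [ex|xc'] := eqVneq x c'.
    by apply: (N4 y z); rewrite // -ex eq_sym.
  have [ey|yc'] := eqVneq y c'; last exact: (N4 x y).
  by apply: (N4 x z); rewrite // -ey eq_sym.
exfalso; apply: noK23.
have soc_c a : soc a -> a != 0 -> a = c.
  by move=> sa a0; apply/eqP; apply: contraT => ac; case: uniq_c; exists a.
have c2 : - c = c.
  by apply: soc_c; [move=> y' zy'; rewrite mulNr sc ?oppr0 | rewrite oppr_eq0].
have xc0 : x * c = 0 by rewrite mulrC.
have nbr (w : S) : w != 0 -> w != c -> x * w = 0 -> [\/ w = x, w = y | w = z] \/ ring_K23.
  move=> w0 wc xw; have [wx|wx] := eqVneq w x; first by left; constructor 1.
  have [wy|wy] := eqVneq w y; first by left; constructor 2.
  have [wz|wz] := eqVneq w z; first by left; constructor 3.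
  right; apply: (@K23I c x y z w); split; rewrite // 1?eq_sym //.
  by apply: kill; apply: (zero_divisorI w0 x0); rewrite mulrC.
have shift (w : S) : nonzero_zero_divisor w -> w != c -> w + c != 0 /\ w + c != c.
  move=> zw wc; have [w0 _] := zero_divisorP zw; split.
    by rewrite addr_eq0 c2.
  by rewrite -subr_eq0 addrK.
have [yc1 yc2] := shift y zy yc; have [zc1 zc2] := shift z zz zneqc.
have [xc1 xc2] := shift x zx xc.
have cK (w : S) : w + c + c = w by rewrite -{2}c2 addrK.
have shiftN (w : S) : w + c != w by rewrite -subr_eq0 addrAC subrr add0r.
have yzc : y + c = z \/ ring_K23.
  have /(nbr _ yc1 yc2)[[e|e|e]|] : x * (y + c) = 0 by rewrite mulrDr exy xc0 addr0.
  - have /(nbr _ zc1 zc2)[[e'|e'|e']|] : x * (z + c) = 0 by rewrite mulrDr exz xc0 addr0.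
    + by move: yz; rewrite -(cK y) -(cK z) e e' eqxx.
    + by left; rewrite -e' cK.
    + by move: (shiftN z); rewrite e' eqxx.
    + by right.
  - by move: (shiftN y); rewrite e eqxx.
  - by left.
  - by right.
case: yzc => // yzc.
have xcy : x + c != y by apply: contra_neq xz => e; rewrite -yzc -e cK.
have xcz : x + c != z by rewrite -yzc (inj_eq (addIr c)).
apply: (@K23I x (x + c) c y z); split; rewrite ?mulrDl ?xc0 ?cc ?exy ?exz ?cy ?cz ?addr0 //;
  by rewrite eq_sym.
Qed.
End Local.
Section Product.
Variable e : S.
Hypotheses (ee : e * e = e) (e0 : e != 0).
Let f := 1 - e.

Let ef : e * f = 0. Proof. by rewrite /f mulrBr mulr1 ee subrr. Qed.
Let ff : f * f = f. Proof. by rewrite {1}/f mulrBl mul1r ef subr0. Qed.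
Let split_ef x : e * x + f * x = x. Proof. by rewrite -mulrDl /f addrC subrK mul1r. Qed.

Let e_kills x : f * x = x -> e * x = 0.
Proof. by move=> <-; rewrite mulrA ef mul0r. Qed.

Let neq_e (a u : S) : e * a = e -> f * u = u -> a != u.
Proof.
move=> ea /e_kills eu; apply: contraNneq e0 => au.
by rewrite -ea au eu.
Qed.

(* otherwise z, d, z + d are common neighbours of e and e + z or, when d = - z,
   e, e + z, e - z are common neighbours of z and - z *)
Let square_zero_unique z d : f * z = z -> f * d = d -> z != 0 -> d != 0 -> z != d ->
  z * z = 0 -> z * d = 0 -> False.
Proof.
move=> fz fd z0 d0 zd0 zz zd; apply: noK23.
have [ez ed] := conj (e_kills fz) (e_kills fd).
have ne (a u : S) : f * a = a -> f * u = u -> e + a != u.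
  by move=> /e_kills ea fu; apply: neq_e; rewrite // mulrDr ea addr0.
have shift (a b : S) : (e + a == e + b) = (a == b) by rewrite (inj_eq (addrI e)).
have shift0 (a : S) : (e == e + a) = (a == 0).
  by rewrite -{1}[e]addr0 shift eq_sym.
have e_ne (u : S) : f * u = u -> e != u by move=> fu; rewrite neq_e.
have nz (a : S) : f * a = a -> e + a != 0 by move=> fa; rewrite ne ?mulr0.
have [zd1|zd1] := eqVneq (z + d) 0; last first.
  have fzd : f * (z + d) = z + d by rewrite mulrDr fz fd.
  have z_zd : z != z + d by rewrite eq_sym -subr_eq0 addrAC subrr add0r.
  have d_zd : d != z + d by rewrite eq_sym -subr_eq0 addrK.
  apply: (@K23I e (e + z) z d (z + d)); split=> //;
    rewrite ?mulrDl ?mulrDr ?ez ?ed ?zz ?zd ?addr0 //;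
    by [exact: nz | exact: e_ne | exact: ne | rewrite shift0].
have dE : d = - z by apply/eqP; rewrite -addr_eq0 addrC zd1.
rewrite dE in zd0 fd d0 ed zd.
have [ze nze] := conj (etrans (mulrC z e) ez) (etrans (mulrC (- z) e) ed).
apply: (@K23I z (- z) e (e + z) (e - z)); split=> //;
  rewrite ?mulrDr ?ze ?nze ?zz ?zd ?mulNr ?mulrN ?zz ?oppr0 ?addr0 ?opprK ?ze //;
  by [exact: nz | rewrite shift0 | rewrite shift | rewrite eq_sym; exact: e_ne |
      rewrite eq_sym; exact: ne].
Qed.

(* otherwise e, e + z, z are common neighbours of d and d', unless z is one of these *)
Let partner_unique z d d' : f * z = z -> f * d = d -> f * d' = d' ->
  z != 0 -> d != 0 -> d' != 0 -> z * d = 0 -> z * d' = 0 -> d = d'.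
Proof.
move=> fz fd fd' z0 d0 d'0 zd zd'; apply/eqP; apply: contraT => dd'.
have [zE|zd1] := eqVneq z d.
  by case: (square_zero_unique fz fd' z0 d'0); rewrite // zE // -{1}zE.
have [zE|zd'1] := eqVneq z d'.
  by case: (square_zero_unique fz fd z0 d0); rewrite // {2}zE.
case: noK23; have [ed ed'] := conj (e_kills fd) (e_kills fd').
have ez := e_kills fz.
have [de d'e] := conj (etrans (mulrC d e) ed) (etrans (mulrC d' e) ed').
have [dz d'z] := conj (etrans (mulrC d z) zd) (etrans (mulrC d' z) zd').
have e_ne (u : S) : f * u = u -> u != e.
  by move=> fu; rewrite eq_sym; apply: neq_e.
have ez_ne (u : S) : f * u = u -> u != e + z.
  by move=> fu; rewrite eq_sym; apply: neq_e; rewrite // mulrDr ee ez addr0.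
have eznz : e + z != 0 by rewrite eq_sym; apply: ez_ne; rewrite mulr0.
have e_ez : e != e + z by rewrite eq_sym -subr_eq0 addrAC subrr add0r.
have e_z : e != z by rewrite eq_sym e_ne.
have ez_z : e + z != z by rewrite eq_sym ez_ne.
apply: (@K23I d d' e (e + z) z); split=> //;
  rewrite ?mulrDr ?de ?d'e ?dz ?d'z ?addr0 //;
  by [exact: e_ne | exact: ez_ne | rewrite eq_sym].
Qed.

(** Here eS = {0, e} and [e] is the hub. Two other vertices are adjacent only if their
    components in (1 - e)S annihilate each other, and a nonzero element of (1 - e)S is
    annihilated by at most one other nonzero element: this is the situation of
    [path_positions]. *)
Lemma product_F2_fan : (forall x, e * x = 0 \/ e * x = e) -> ring_fan.
Proof.
move=> two; pose p (u v : S) := [&& u != 0, v != 0, f * u == u, f * v == v & u * v == 0].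
have pC : symmetric p.
  by move=> u v; rewrite /p (mulrC u v); case: (u == 0); case: (v == 0);
    case: (f * u == u); case: (f * v == v).
have pU u v w : p u v -> p u w -> v = w.
  move=> /and5P[u0 v0 /eqP fu /eqP fv /eqP uv] /and5P[_ w0 _ /eqP fw /eqP uw].
  exact: (partner_unique fu fv fw).
have [pos [posI posp]] := path_positions (fun s => f * s) (fun s => e * s != 0) pC pU.
have sep x y : f * x = f * y -> (e * x != 0) = (e * y != 0) -> x = y.
  move=> fxy exy; suff exy' : e * x = e * y by rewrite -[x]split_ef exy' fxy split_ef.
  by move: exy; have [->|->] := two x; have [->|->] := two y; rewrite ?eqxx ?e0.
exists (pred1 e), pos; split=> [x y /eqP-> /eqP->//|x y _ _ _ _ /posI[]|].
  exact: sep.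
move=> x y /zero_divisorP[x0 _] /zero_divisorP[y0 _] xy exy xe ye.
have b0 w : w != 0 -> w != e -> f * w != 0.
  move=> w0 we; apply: contraNneq we => fw.
  have wE : w = e * w by rewrite -[LHS]split_ef fw addr0.
  by move: w0; rewrite wE; have [->|->] := two w; rewrite eqxx.
apply: posp.
- by apply/and5P; split; rewrite ?b0 //;
    first [rewrite mulrACA exy mulr0 | rewrite mulrA ff].
- have [->|ex] := two x; first by rewrite eqxx.
  have [->|ey] := two y; first by rewrite eqxx andbF.
  by move: e0; rewrite -ee -{1}ex -ey mulrACA exy mulr0 eqxx.
apply: contraT; rewrite negb_or !negbK => /andP[/eqP fxy /eqP exyb].
by move: xy; rewrite (sep _ _ fxy exyb) eqxx.
Qed.

End Product.

(** Both factors have at least three elements. If one had four, the bipartite graph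
    between them would contain K_{2,3}; hence both have three, the zero divisors are
    e, -e and their analogues f, -f, and the graph is a 4-cycle. *)
Lemma product_F3_fan e x y : e * e = e -> e != 0 -> 1 - e != 0 ->
  e * x != 0 -> e * x != e -> (1 - e) * y != 0 -> (1 - e) * y != 1 - e -> ring_fan.
Proof.
move=> ee e0 f0; set f := 1 - e; set a := e * x; set b := f * y => a0 ae b0 bf.
have ef : e * f = 0 by rewrite /f mulrBr mulr1 ee subrr.
have ff : f * f = f by rewrite {1}/f mulrBl mul1r ef subr0.
have ea : e * a = a by rewrite /a mulrA ee.
have fb : f * b = b by rewrite /b mulrA ff.
have prod0 (u v : S) : e * u = u -> f * v = v -> u * v = 0.
  by move=> <- <-; rewrite mulrACA ef mul0r.
have disj (u v : S) : e * u = u -> f * v = v -> u != 0 -> u != v.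
  move=> eu fv u0; apply: contraNneq u0 => uv.
  by rewrite -eu uv -fv mulrA ef mul0r.
have onlyF (v : S) : f * v = v -> v != 0 -> v = f \/ v = b.
  move=> fv v0; have [|vf] := eqVneq v f; [by left | right].
  apply/eqP; apply: contraT => vb; case: noK23.
  by apply: (@K23I e a f b v); split=> //;
    by [exact: disj | exact: prod0 | rewrite eq_sym].
have onlyE (u : S) : e * u = u -> u != 0 -> u = e \/ u = a.
  move=> eu u0; have [|ue] := eqVneq u e; [by left | right].
  apply/eqP; apply: contraT => ua; case: noK23.
  by apply: (@K23I f b e a u); split=> //;
    by [rewrite eq_sym; exact: disj | rewrite mulrC; exact: prod0 | rewrite eq_sym].
have aE : a = - e.
  apply/eqP; rewrite -addr_eq0; apply: contraT => n0.
  have eae : e * (a + e) = a + e by rewrite mulrDr ea ee.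
  have [E|E] := onlyE _ eae n0.
    by move: a0; rewrite -(addrK e a) E subrr eqxx.
  by move: e0; rewrite -(addKr a e) E addNr eqxx.
have bE : b = - f.
  apply/eqP; rewrite -addr_eq0; apply: contraT => n0.
  have fbf : f * (b + f) = b + f by rewrite mulrDr fb ff.
  have [E|E] := onlyF _ fbf n0.
    by move: b0; rewrite -(addrK f b) E subrr eqxx.
  by move: f0; rewrite -/f -(addKr b f) E addNr eqxx.
have vertex s : nonzero_zero_divisor s -> s != e -> s \in [:: f; - e; - f].
  move=> /zero_divisorP[s0 [t t0 st]] se.
  have sE : e * s + f * s = s by rewrite -mulrDl /f addrC subrK mul1r.
  have [es|es] := eqVneq (e * s) 0.
    have fs : f * s = s by rewrite -[RHS]sE es add0r.
    by have [->|->] := onlyF _ fs s0; rewrite ?bE !inE eqxx ?orbT.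
  have [fs|fs] := eqVneq (f * s) 0.
    have es' : e * s = s by rewrite -[RHS]sE fs addr0.
    have [E|->] := onlyE _ es' s0; first by rewrite E eqxx in se.
    by rewrite aE !inE eqxx orbT.
  have ss : s * s = 1.
    have sq (u v : S) : u * u = u -> v = u \/ v = - u -> v * v = u.
      by move=> uu [] ->; rewrite ?mulrNN.
    have es2 : e * s * (e * s) = e.
      by apply: sq => //; rewrite -aE; apply: onlyE; rewrite // mulrA ee.
    have fs2 : f * s * (f * s) = f.
      by apply: sq => //; rewrite -bE; apply: onlyF; rewrite // mulrA ff.
    have efs : e * s * (f * s) = 0 by apply: prod0; rewrite mulrA ?ee ?ff.
    rewrite -{1 2}sE mulrDl !mulrDr es2 fs2 efs [f * s * _]mulrC efs.
    by rewrite add0r addr0 /f addrC subrK.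
  by move: t0; rewrite -[t]mul1r -ss -mulrA st mulr0 eqxx.
exists (pred1 e), (fun s => index s [:: f; - e; - f]).
split=> [u v /eqP-> /eqP->//|u v zu zv ue ve|u v zu zv uv euv ue ve].
  by apply: (@index_inj _ f) ; apply: vertex.
have fNf : f != - f by rewrite -bE eq_sym.
have eNf : - e != - f.
  by rewrite (inj_eq oppr_inj) disj.
have feN : f != - e by rewrite eq_sym disj ?mulrN ?ee ?oppr_eq0.
have i1 : index (- e) [:: f; - e; - f] = 1%N by rewrite /= (negPf feN) eqxx.
have i2 : index (- f) [:: f; - e; - f] = 2%N.
  by rewrite /= (negPf fNf) (negPf eNf) eqxx.
have i0 : index f [:: f; - e; - f] = 0%N by rewrite /= eqxx.
move: (vertex _ zu ue) (vertex _ zv ve) euv uv; rewrite !inE.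
case/or3P=> /eqP->; case/or3P=> /eqP->; rewrite ?eqxx ?i0 ?i1 ?i2 //; try by [left|right].
- by rewrite mulrN ff => /eqP; rewrite oppr_eq0 -/f (negPf f0).
- by rewrite mulNr ff => /eqP; rewrite oppr_eq0 -/f (negPf f0).
Qed.

End Trichotomy.

Lemma zero_divisor_trichotomy (S : finComNzRingType) :
  [\/ ring_K23 S, ring_null4 S | ring_fan S].
Proof.
have [|noK23] := pselect (ring_K23 S); first by constructor 1.
have [[e [ee e0 e1]]|noidem] :=
    pselect (exists e : S, [/\ (e * e)%R = e, e != 0%R & e != 1%R]); last first.
  have [e ee||] := local_trichotomy noK23; [|by constructor 2|by constructor 3].
  have [->|e0] := eqVneq e 0%R; [by left | right].
  by apply/eqP; apply: contraT => e1; case: noidem; exists e.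
constructor 3; have f0 : (1 - e != 0)%R by rewrite subr_eq0 eq_sym.
have ff : ((1 - e) * (1 - e) = 1 - e)%R by rewrite mulrBl mul1r mulrBr mulr1 ee subrr subr0.
have [two|] := pselect (forall x : S, (e * x = 0 \/ e * x = e)%R).
  exact: (product_F2_fan noK23 ee e0 two).
move=> /existsNP[x /not_orP[/eqP ex0 /eqP exe]].
have [two|] := pselect (forall x : S, ((1 - e) * x = 0 \/ (1 - e) * x = 1 - e)%R).
  exact: (product_F2_fan noK23 ff f0 two).
move=> /existsNP[y /not_orP[/eqP fy0 /eqP fyf]].
exact: (product_F3_fan noK23 ee e0 f0 ex0 exe fy0 fyf).
Qed.

(** * Blowing up the zero-divisor graph *)

Section Obstruction.
Variables (K : realType) (G : sgraph).
Local Open Scope ereal_scope.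

Lemma genus_ge2 : ~ drawable (surface (K := K) 0) G ->
  ~ drawable (surface (K := K) 1) G -> 2%:E <= genus K G.
Proof.
move=> no0 no1; apply/ereal_infP => _ [g /= dg <-].
rewrite lee_fin ler_nat; case: g dg => [|[|g]] //.
Qed.

(** On the sphere, K_5 on the first five vertices, with [ord_max] as the vertex that is
    removed. *)
Lemma genus_K8 (v : 'I_8 -> G) : injective v ->
  (forall i j, i != j -> adj (v i) (v j)) -> 2%:E <= genus K G.
Proof.
move=> vI vA; apply: genus_ge2; last first.
  by move=> /torus_coordinates[h [u [r H]]]; exact: (no_parity_data_K8 H vI vA).
move=> /(sphere_coordinates (v ord_max))[h [u [r [H h0]]]].
pose w (i : 'I_5) := v (inord i).
have wI : injective w.
  move=> i j /vI/(congr1 val); rewrite /= !inordK; [exact: ord_inj | |];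
  exact: ltn_trans (ltn_ord _) _.
have w_ne i : w i != v ord_max.
  rewrite (inj_eq vI) -val_eqE /= inordK ?neq_ltn ?(ltn_trans (ltn_ord i)) //.
apply: (no_planar_parity_data_K5 H wI) h0 => i j ij /=; rewrite !w_ne !andbT.
by apply: vA; apply: contra_neq ij => e; apply: wI; rewrite /w e.
Qed.

Lemma genus_K46 (v : 'I_4 -> G) (w : 'I_6 -> G) : injective v -> injective w ->
  (forall i j, adj (v i) (w j)) -> 2%:E <= genus K G.
Proof.
move=> vI wI vw.
have ne i j : v i != w j by apply: contraTneq (vw i j) => ->; rewrite adj_irr.
apply: genus_ge2; last first.
  by move=> /torus_coordinates[h [u [r H]]]; exact: (no_parity_data_K46 H vI wI ne vw).
move=> /(sphere_coordinates (v ord_max))[h [u [r [H h0]]]].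
pose v' (i : 'I_3) := v (inord i); pose w' (i : 'I_3) := w (inord i).
have v'I : injective v'.
  move=> i j /vI/(congr1 val); rewrite /= !inordK; [exact: ord_inj | |];
  exact: ltn_trans (ltn_ord _) _.
have w'I : injective w'.
  move=> i j /wI/(congr1 val); rewrite /= !inordK; [exact: ord_inj | |];
  exact: ltn_trans (ltn_ord _) _.
apply: (no_planar_parity_data_K33 H v'I w'I) h0 => [i j|i j] /=; first exact: ne.
rewrite vw eq_sym (eq_sym (w' j)) ne andbT /= eq_sym (inj_eq vI) -val_eqE /= inordK.
  by rewrite neq_ltn ltn_ord.
exact: ltn_trans (ltn_ord _) _.
Qed.

End Obstruction.

Section BlowUp.
Variables (R : finComNzRingType) (I : idealr R) (i0 : R).
Hypotheses (i0I : i0 \in I) (i0_neq0 : i0 != 0%R).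
Local Open Scope ring_scope.
Local Notation S := {ideal_quot I}.

Let pi (r : R) : S := (\pi_S r)%qT.

Let pi_eq0 r : (pi r == 0) = (r \in I).
Proof.
by have := Quotient.idealrBE I r 0; rewrite subr0 => ->; rewrite /pi (rmorph0 (\pi_S)%qT).
Qed.

Let piM r s : pi (r * s) = pi r * pi s.
Proof. exact: rmorphM. Qed.

(* two elements in each coset, since i0 is a nonzero element of I *)
Let lift (x : S) (t : bool) : R := repr x + (if t then i0 else 0).

Let pi_lift x t : pi (lift x t) = x.
Proof.
rewrite /pi /lift rmorphD /= reprK; case: t; last by rewrite rmorph0 addr0.
have /eqP e0 : pi i0 == 0 by rewrite pi_eq0.
by rewrite [X in _ + X](e0 : (\pi_S i0)%qT = 0) addr0.
Qed.

Let lift_inj x y s t : lift x s = lift y t -> x = y /\ s = t.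
Proof.
move=> e; have xy : x = y by rewrite -(pi_lift x s) e pi_lift.
split=> //; move: e; rewrite xy => /addrI.
by case: s; case: t => // /eqP; rewrite ?[0 == _]eq_sym (negPf i0_neq0).
Qed.

Let lift_mul x y s t : x * y = 0 -> lift x s * lift y t \in I.
Proof. by rewrite -pi_eq0 piM !pi_lift => ->. Qed.

Let lift_zd x y t : x != 0 -> y != 0 -> x * y = 0 -> ideal_zero_divisor I (lift x t).
Proof.
move=> x0 y0 xy; rewrite /ideal_zero_divisor -pi_eq0 pi_lift x0.
by apply/existsP; exists (lift y false); rewrite -pi_eq0 pi_lift y0 lift_mul.
Qed.

(** Doubling the vertices of K_{2,3} gives K_{4,6}; the i-th vertex is a lift of the
    entry of index i./2, and the parity of i tells which lift. *)
Lemma blowup_K23 (K : realType) : ring_K23 S ->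
  (2%:E <= genus K (ideal_zero_divisor_graph I))%E.
Proof.
case=> x1 [x2 [y1 [y2 [y3 []]]]]; rewrite [uniq _]/=.
set xs := [:: x1; x2]; set ys := [:: y1; y2; y3] => U C.
pose x (i : 'I_4) := nth 0 xs i./2; pose y (i : 'I_6) := nth 0 ys i./2.
have xm i : x i \in xs by rewrite mem_nth //= -divn2 ltn_divLR.
have ym i : y i \in ys by rewrite mem_nth //= -divn2 ltn_divLR.
have xys : uniq ((0 : S) :: xs ++ ys) by [].
have xs0 a : a \in xs -> a != 0.
  by move=> ax; apply: contraTneq xys => <-; rewrite cons_uniq mem_cat ax.
have ys0 a : a \in ys -> a != 0.
  by move=> ay; apply: contraTneq xys => <-; rewrite cons_uniq mem_cat ay orbT.
have [uxs [dis uys]] : uniq xs /\ ~~ has [in xs] ys /\ uniq ys.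
  by move: xys; rewrite cons_uniq cat_uniq => /andP[_ /and3P[? ? ?]].
have [x1m y1m] : x1 \in xs /\ y1 \in ys by rewrite !inE !eqxx.
have xz i : ideal_zero_divisor I (lift (x i) (odd i)).
  by apply: (@lift_zd _ y1); [exact: xs0 | exact: ys0 | exact: C].
have yz i : ideal_zero_divisor I (lift (y i) (odd i)).
  by apply: (@lift_zd _ x1); [exact: ys0 | exact: xs0 | rewrite mulrC; exact: C].
pose G := ideal_zero_divisor_graph I.
pose v i : G := exist (ideal_zero_divisor I) _ (xz i).
pose w i : G := exist (ideal_zero_divisor I) _ (yz i).
apply: (@genus_K46 K G v w).
- move=> i j [/lift_inj[/eqP]]; rewrite nth_uniq ?[size _]/= -1?divn2 ?ltn_divLR // !divn2.
  move=> /eqP e1 e2; apply: val_inj; rewrite /= -(odd_double_half i) e1 e2.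
  exact: odd_double_half.
- move=> i j [/lift_inj[/eqP]]; rewrite nth_uniq ?[size _]/= -1?divn2 ?ltn_divLR // !divn2.
  move=> /eqP e1 e2; apply: val_inj; rewrite /= -(odd_double_half i) e1 e2.
  exact: odd_double_half.
move=> i j; rewrite /= /izdg_adj /= lift_mul ?C // andbT -val_eqE /=.
apply/eqP => /lift_inj[e _]; move/hasPn: dis => /(_ _ (ym j)).
by rewrite -e xm.
Qed.

(** Both lifts of an element are adjacent as well, because its square is 0. *)
Lemma blowup_null4 (K : realType) : ring_null4 S ->
  (2%:E <= genus K (ideal_zero_divisor_graph I))%E.
Proof.
case=> a [b [c [d []]]]; set xs := [:: a; b; c; d] => U C.
pose x (i : 'I_8) := nth 0 xs i./2.
have xm i : x i \in xs by rewrite mem_nth //= -divn2 ltn_divLR.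
move: U; rewrite cons_uniq => /andP[xs0 U].
have x0 i : x i != 0 by apply: contraNneq xs0 => <-.
have xz i : ideal_zero_divisor I (lift (x i) (odd i)).
  by apply: (@lift_zd _ (x i)); rewrite ?C.
pose G := ideal_zero_divisor_graph I.
pose v i : G := exist (ideal_zero_divisor I) _ (xz i).
apply: (@genus_K8 K G v).
  move=> i j [/lift_inj[/eqP]]; rewrite nth_uniq ?[size _]/= -1?divn2 ?ltn_divLR // !divn2.
  move=> /eqP e1 e2; apply: val_inj; rewrite /= -(odd_double_half i) e1 e2.
  exact: odd_double_half.
move=> i j ij; rewrite /= /izdg_adj /= lift_mul ?C // andbT -val_eqE /=.
apply: contra_neq ij => /lift_inj[/eqP].
rewrite nth_uniq ?[size _]/= -1?divn2 ?ltn_divLR // !divn2.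
move=> /eqP e1 e2; apply: val_inj; rewrite /= -(odd_double_half i) e1 e2.
exact: odd_double_half.
Qed.

End BlowUp.

Lemma clique_number_ge4 (G : sgraph) : (4 <= clique_number G)%N ->
  has_complete_subgraph G 4.
Proof.
move=> C; apply: contraTT C; rewrite -ltnNge ltnS => no.
apply/bigmax_leqP => n /existsP[f /andP[/injectiveP fI /forallP fA]].
rewrite leqNgt; apply: contra no => n4; apply/existsP.
exists [ffun i : 'I_4 => f (widen_ord n4 i)]; apply/andP; split.
  by apply/injectiveP => i j; rewrite !ffunE => /fI/(congr1 val) e; exact: val_inj.
apply/forallP => i; apply/forallP => j; rewrite !ffunE.
by have /forallP/(_ (widen_ord n4 j)) := fA (widen_ord n4 i).
Qed.

Lemma ring_fan_is_fan (S : finComNzRingType) : ring_fan S ->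
  exists hub pos, is_fan (@adj (zero_divisor_graph S)) hub pos.
Proof.
case=> hub [pos [h1 h2 h3]].
exists (fun x => hub (val x)), (fun x => pos (val x)); split.
- by move=> x y hx hy; apply: val_inj; exact: h1.
- by move=> x y hx hy e; apply: val_inj; apply: h2 => //; exact: valP.
move=> x y /andP[xy /eqP e] hx hy; apply: h3 => //; exact: valP.
Qed.

Theorem theorem4p16 (K : realType) (R : finComNzRingType) (I : idealr R)
    (I_neq0 : exists2 x : R, x \in I & x != 0%R) :
  (4 <= clique_number (zero_divisor_graph {ideal_quot I}))%N \/
  (1 <= genus K (zero_divisor_graph {ideal_quot I}))%E ->
  (2%:E <= genus K (ideal_zero_divisor_graph I))%E.
Proof.
case: I_neq0 => i0 i0I i0_neq0.
have [K23|null4|/ring_fan_is_fan[hub [pos fan]]] :=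
    zero_divisor_trichotomy {ideal_quot I}.
- by move=> _; exact: blowup_K23 i0I i0_neq0 _ K23.
- by move=> _; exact: blowup_null4 i0I i0_neq0 _ null4.
case=> [/clique_number_ge4/(fan_no_K4 fan)[]|].
have le0 : (genus K (zero_divisor_graph {ideal_quot I}) <= 0%:E)%E.
  by apply: ereal_inf_lbound; exists 0%N => //=; exact: (fan_drawable K fan).
by move=> /le_trans/(_ le0); rewrite lee_fin ler10.
Qed.
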